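(* Let $n>2$ and let $L(y)=a_n(x)y^{(n)}+a_{n-1}(x)y^{(n-1)}+\cdots+a_2(x)y''+a_1(x)y'$ be a self-adjoint operator of order $n$, where each $a_k$ is a real polynomial of degree at most $k$ and $a_n\not\equiv0$. If $a_n$ has a real root, then the multiplicity of the root in $a_n$ is at least $2$, and the multiplicity of the same root in $a_{n-1}$ is positive and less than its multiplicity in $a_n$.
   Context: Self-adjointness is understood as follows. $I$ is an open interval whose finite endpoints are real zeros of $a_n$ and which contains no zero of $a_n$ (its endpoints are consecutive zeros of $a_n$, or $\pm\infty$). The weight is $p(x)=\frac{1}{|a_n(x)|}\exp\big(\frac2n\int_{p_0}^x\frac{a_{n-1}(t)}{a_n(t)}dt\big)$ on $I$ ($p_0\in I$), and it is admissible: $\int_I p|u|\,dx<\infty$ for every polynomial $u$. $L$ is self-adjoint if $\int_I p\,(Ly)\,u\,dx=\int_I p\,y\,(Lu)\,dx$ for all $y,u\in C^\infty$, where $C^\infty$ is read as the space of real-valued infinitely differentiable functions on $I$ all of whose derivatives (including order $0$) are bounded on $I$ by polynomials. *)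

(* Defs.v *)
From mathcomp Require Import all_boot all_order all_algebra.
From mathcomp Require Import all_classical all_reals all_analysis.

Set Implicit Arguments.
Unset Strict Implicit.
Unset Printing Implicit Defensive.

Import Order.TTheory GRing.Theory Num.Theory.
Import numFieldNormedType.Exports.

Local Open Scope classical_set_scope.
Local Open Scope ring_scope.

Section SelfAdjointOperators.
Context {R : realType}.
Implicit Types (a : nat -> {poly R}) (n : nat) (I : set R) (p y u : R -> R).

Definition open_interval (l r : \bar R) : set R :=
  [set x | (l < x%:E)%E /\ (x%:E < r)%E].

Definition between_zeros (q : {poly R}) (l r : \bar R) : Prop :=
  [/\ forall c : R, l = c%:E \/ r = c%:E -> root q c
    & forall x : R, open_interval l r x -> ~~ root q x].

(* The integral from s to x with the usual sign convention when x < s. *)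
Definition oriented_integral (s x : R) (f : R -> R) : R :=
  if s <= x then \int[lebesgue_measure]_(t in `[s, x]) f t
  else - \int[lebesgue_measure]_(t in `[x, s]) f t.

(* a k is the coefficient of y^(k); only a 1, ..., a n are used. *)
Definition diffop a n y (x : R) : R :=
  \sum_(1 <= k < n.+1) (a k).[x] * derive1n k y x.

Definition weight a n (p0 x : R) : R :=
  `|(a n).[x]|^-1 *
  expR (2 / n%:R *
        oriented_integral p0 x (fun t => (a n.-1).[t] / (a n).[t])).

Definition admissible I p : Prop :=
  forall q : {poly R},
    (\int[lebesgue_measure]_(x in I) (p x * `|q.[x]|)%:E < +oo)%E.

(* A function on the open set I is represented by a total function; its
   iterated derivatives at points of I only depend on its values on I. *)
Definition smooth_on I y : Prop :=
  forall (k : nat) (x : R), I x -> derivable (derive1n k y) x 1.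

Definition poly_bounded_derivatives I y : Prop :=
  forall k : nat, exists q : {poly R},
    forall x : R, I x -> `|derive1n k y x| <= q.[x].

Definition test_function I y : Prop :=
  smooth_on I y /\ poly_bounded_derivatives I y.

Definition self_adjoint I p a n : Prop :=
  forall y u, test_function I y -> test_function I u ->
    \int[lebesgue_measure]_(x in I) (p x * diffop a n y x * u x) =
    \int[lebesgue_measure]_(x in I) (p x * y x * diffop a n u x).

End SelfAdjointOperators.

(* Main.v *)
Require Import Defs.
From mathcomp Require Import all_boot all_order all_algebra.
From mathcomp Require Import all_classical all_reals all_analysis.
From mathcomp Require Import measurable_realfun ring lra.

Set Implicit Arguments.
Unset Strict Implicit.
Unset Printing Implicit Defensive.

Import Order.TTheory GRing.Theory Num.Theory.
Import numFieldNormedType.Exports.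

Local Open Scope classical_set_scope.
Local Open Scope ring_scope.

(** Every real root of [a n] turns out to be a finite endpoint of the interval,
    and the claim is proved at the endpoints.

    Let [e] be a finite endpoint and [X = sg * (x - e)], [sg = 1] or [-1], be
    the coordinate that is positive on the interval.  The functions
    [expR (- s * X)] with [s >= 0] are admissible test functions, and [L] acts
    on them by multiplication by a polynomial in [s] whose coefficients are
    polynomials in [X].  Self-adjointness against [expR (- (t - s) * X)]
    therefore says that a polynomial of degree [n] in [s / t], whose
    coefficients are the numbers [(- t) ^+ k] times the integral of
    [p * A k * expR (- t * X)], is invariant under [z |-> 1 - z].  Such a
    polynomial is a polynomial in [z * (1 - z)].  Hence [n = 2 m] is even, the
    two leading coefficients determine each other, and the leading coefficient
    is bounded by those of degree at most [m]
    ([reflection_invariant_lead_le]).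

    As [t] grows, the integrals concentrate at [e], so that [A k] may be
    replaced by its lowest monomial [X ^+ i].  With alpha and beta the
    multiplicities of [e] in [a n] and [a n.-1], and Phi_i the integral of
    [p * X ^+ i * expR (- t * X)], the relation between the two leading
    coefficients reads t Phi_alpha ~ c Phi_beta and the bound reads
    t^n Phi_alpha <= K t^m Phi_0.  The former excludes beta >= alpha, both
    together exclude beta = 0, and the latter gives alpha >= m, since
    t^(alpha + 1) Phi_alpha <= K Phi_0 for all large t is impossible
    ([laplace_no_collapse]).  This is [endpoint_order].

    It remains to see that there are no other roots.  If both endpoints are
    finite, they use up the degree, as each has multiplicity at least [m].  If
    only one is finite, the test functions [X ^+ i] and [X ^+ j] with
    [i + j = N] large play the role of the exponentials: they concentrate at
    infinity and give that [a n] has degree at most [m] ([infinity_order]), so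
    that the single endpoint already uses it up. *)

(** * Polynomials invariant under the reflection about 1/2 *)

Section SymmetricPolynomials.
Context {R : realFieldType}.
Implicit Types G H : {poly R}.

Definition reflection_invariant G := G \Po (1 - 'X) = G.

Lemma reflection_invariant_grid G (N : nat) :
  (0 < N)%N -> (size G <= N.+1)%N ->
  (forall i, (i <= N)%N -> G.[i%:R / N%:R] = G.[(N - i)%:R / N%:R]) ->
  reflection_invariant G.
Proof.
move=> N0 sG h; apply/eqP; rewrite -subr_eq0; apply/eqP.
have NR : N%:R != 0 :> R by rewrite pnatr_eq0 -lt0n.
apply: (@roots_geq_poly_eq0 _ _ [seq i%:R / N%:R | i <- iota 0 N.+1]).
- apply/allP => x /mapP[i]; rewrite mem_iota add0n ltnS => /= iN ->.
  rewrite rootE !hornerE horner_comp !hornerE h//.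
  by rewrite natrB// mulrBl divff// subrr.
- rewrite map_inj_uniq ?iota_uniq// => i j /(mulIf (invr_neq0 NR)) /eqP.
  by rewrite eqr_nat => /eqP.
- rewrite size_map size_iota; apply: (leq_trans (size_polyD _ _)).
  rewrite size_polyN geq_max sG andbT size_comp_poly2//.
  by rewrite -opprB size_polyN size_XsubC.
Qed.

(** A polynomial invariant under [z |-> 1 - z] that vanishes at [0] also
    vanishes at [1]; dividing by ['X * (1 - 'X)] allows inductions that lower
    the degree by two. *)
Lemma reflection_invariant_split G : reflection_invariant G ->
  exists2 H, reflection_invariant H & G = (G`_0)%:P + 'X * (1 - 'X) * H.
Proof.
move=> sG.
have r0 : root (G - (G`_0)%:P) 0 by rewrite rootE !hornerE horner_coef0 subrr.
have sG' x : G.[1 - x] = G.[x] by rewrite -{2}sG horner_comp !hornerE.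
have /factor_theorem[H1 e1] := r0; rewrite subr0 in e1.
have r1 : root H1 1.
  have : (G - (G`_0)%:P).[1] = 0 by rewrite !hornerE -sG' subrr horner_coef0 subrr.
  by rewrite e1 !hornerE => /eqP.
have /factor_theorem[H2 e2] := r1.
have e : G = (G`_0)%:P + 'X * (1 - 'X) * (- H2).
  by apply/eqP; rewrite addrC -subr_eq e1 e2; apply/eqP; rewrite -polyC1; ring.
exists (- H2) => //.
have nz : 'X * (1 - 'X) != 0 :> {poly R}.
  by rewrite mulf_neq0 ?polyX_eq0// -opprB oppr_eq0 polyXsubC_eq0.
apply: (mulfI nz); apply: (addrI (G`_0)%:P); rewrite -e -[RHS]sG [X in _ = X \Po _]e.
rewrite comp_polyD comp_polyC !comp_polyM comp_polyB comp_polyX.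
by rewrite -[1 in RHS]/(1%:P) comp_polyC polyC1 [X in _ = _ + (_ * X) * _]subKr; ring.
Qed.

Lemma size_XM1subX H k : (size ('X * (1 - 'X) * H)%R <= k.+2)%N -> (size H <= k)%N.
Proof.
have [->|H0] := eqVneq H 0; first by rewrite size_poly0.
have -> : 'X * (1 - 'X) * H = - (('X - 1%:P) * ('X * H)) by rewrite polyC1; ring.
rewrite size_polyN size_monicM ?monicXsubC ?mulf_neq0 ?polyX_eq0//.
by rewrite size_XsubC /= mulrC size_mulX// => /ltnSE /ltnSE.
Qed.

Lemma coef_XM1subX H k :
  ('X * (1 - 'X) * H)`_k.+1 = H`_k - (if k is k'.+1 then H`_k' else 0).
Proof.
have -> : 'X * (1 - 'X) * H = (H - H * 'X) * 'X by ring.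
by rewrite coefMX /= coefB coefMX; case: k.
Qed.

(** Each splitting lowers the degree by two, so parity separates the base
    cases; an invariant polynomial of degree at most one is constant. *)
Lemma reflection_invariant_ind (P : nat -> {poly R} -> Prop) :
  (forall G, reflection_invariant G -> (size G <= 1)%N -> P 0%N G) ->
  (forall G, reflection_invariant G -> (size G <= 1)%N -> P 1%N G) ->
  (forall k (H : {poly R}) c, reflection_invariant H -> (size H <= k.+1)%N -> P k H ->
     P k.+2 (c%:P + 'X * (1 - 'X) * H)) ->
  forall k G, reflection_invariant G -> (size G <= k.+1)%N -> P k G.
Proof.
move=> h0 h1 h; elim/ltn_ind => -[|[|k]] IH G sG szG; first exact: h0.
- apply: h1 => //; have [H _ e] := reflection_invariant_split sG.
  have : (size H <= 0)%N.
    apply: size_XM1subX; rewrite -[_ * H](addKr (G`_0)%:P) -e.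
    apply: (leq_trans (size_polyD _ _)); rewrite geq_max szG size_polyN.
    by rewrite (leq_trans (size_polyC_leq1 _)).
  by rewrite leqn0 size_poly_eq0 e => /eqP ->; rewrite mulr0 addr0 size_polyC_leq1.
- have [H sH e] := reflection_invariant_split sG.
  have szH : (size H <= k.+1)%N.
    apply: size_XM1subX; rewrite -[_ * H](addKr (G`_0)%:P) -e.
    apply: (leq_trans (size_polyD _ _)); rewrite geq_max szG size_polyN.
    by rewrite (leq_trans (size_polyC_leq1 _)).
  by rewrite e; apply: h => //; apply: IH.
Qed.

(** The leading terms of [G (z)] and [G (1 - z)] differ by the sign
    [(- 1) ^+ k]. *)
Lemma reflection_invariant_even G k :
  reflection_invariant G -> (size G <= k.+1)%N -> G`_k != 0 -> ~~ odd k.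
Proof.
move=> sG szG; apply: contraNN => ok; apply/eqP; move: ok; move: k G sG szG.
apply: reflection_invariant_ind => //.
- by move=> G _ sz _; rewrite nth_default.
- move=> k H c sH szH IH /=; rewrite negbK => ok.
  by rewrite coefD coefC /= add0r coef_XM1subX IH// nth_default// subrr.
Qed.

(** The roots of [G] are symmetric about 1/2, so their sum is half of the
    degree. *)
Lemma reflection_invariant_coef_pred G k :
  reflection_invariant G -> (size G <= k.+2)%N ->
  G`_k.+1 != 0 -> G`_k *+ 2 = - (k.+1%:R * G`_k.+1).
Proof.
move=> sG szG g.
pose P k G := if k is k'.+1 then
  ~~ odd k -> (G : {poly R})`_k' *+ 2 = - (k'.+1%:R * G`_k'.+1) else True.
have : P k.+1 G; last by apply; exact: reflection_invariant_even g.
move: k.+1 G sG szG {g}; apply: reflection_invariant_ind => //.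
case=> [|j] H c sH szH /= IH.
  move=> _; rewrite !coefD !coefC /= !add0r !coef_XM1subX (@nth_default _ _ H 1)//.
  by rewrite subr0 sub0r mulrN opprK mulr_natl.
rewrite negbK => /IH e; rewrite !coefD !coefC /= !add0r !coef_XM1subX.
rewrite (@nth_default _ _ H j.+2)// mulrnBl e sub0r mulrN !opprK.
by rewrite -[j.+3]/(2 + j.+1)%N natrD; ring.
Qed.

(** The low half of the coefficients of an invariant polynomial determines all
    of them: it is a polynomial in [z * (1 - z)].  The factorial only has to be
    independent of [G]. *)
Lemma reflection_invariant_lead_le G m :
  reflection_invariant G -> (size G <= m.*2.+1)%N ->
  `|G`_m.*2| <= m`!%:R * \sum_(k < m.+1) `|G`_k|.
Proof.
pose P k G := ~~ odd k -> `|(G : {poly R})`_k| <= (k./2)`!%:R * \sum_(j < k./2.+1) `|G`_j|.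
move=> sG szG; have : P m.*2 G; last first.
  by rewrite /P odd_double doubleK; apply.
move: m.*2 G sG szG; apply: reflection_invariant_ind => //.
- by move=> G _ _ _; rewrite big_ord1 mul1r.
move=> k H c sH szH; rewrite /P /= negbK => IH ok.
set G := _ + _.
have GS j : G`_j.+1 = H`_j - (if j is k'.+1 then H`_k' else 0).
  by rewrite coefD coefC /= add0r coef_XM1subX.
(* dividing by 1 - 'X sums coefficients, which costs the factor k./2.+1 *)
have HE j : H`_j = \sum_(i < j.+1) G`_i.+1.
  elim: j => [|j IHj]; first by rewrite big_ord1 GS subr0.
  by rewrite big_ord_recr -IHj GS /=; ring.
have Hle j : (j < k./2.+1)%N -> `|H`_j| <= \sum_(i < k./2.+2) `|G`_i|.
  move=> jk; rewrite HE (le_trans (ler_norm_sum _ _ _))//.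
  rewrite [leRHS]big_ord_recl ler_wpDl//.
  rewrite -!(big_mkord xpredT (fun i => `|G`_i.+1|)).
  by rewrite [leRHS](big_cat_nat (n := j.+1))//= lerDl sumr_ge0.
rewrite GS (@nth_default _ _ H k.+1)// sub0r normrN (le_trans (IH ok))//.
rewrite factS mulnC natrM -mulrA ler_wpM2l// mulr_natl.
rewrite -[X in _ *+ X](card_ord k./2.+1) -sumr_const.
by apply: ler_sum => j _; apply: Hle.
Qed.

End SymmetricPolynomials.
(** * Positive functionals on the half line and their Laplace transforms *)

Section HalfLineMean.
Context {R : realType}.
Implicit Types (f g : R -> R) (E : (R -> R) -> R) (A B : {poly R}).

(** The class on which integration against an admissible weight is linear and
    monotone. *)
Definition tame f :=
  continuous f /\ exists q : {poly R}, forall x, 0 < x -> `|f x| <= q.[x].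

(** What the argument uses of the integral against a density on an interval
    with left end 0: points near 0 carry mass, but 0 itself does not; the
    latter is [mean_decay]. *)
Record half_line_mean E : Prop := HalfLineMean {
  mean_linear : forall c f g, tame f -> tame g ->
    E (fun x => c * f x + g x) = c * E f + E g;
  mean_le : forall f g, tame f -> tame g ->
    (forall x, 0 < x -> f x <= g x) -> E f <= E g;
  mean_gt0 : forall f (eta : R), tame f -> (forall x, 0 < x -> 0 <= f x) ->
    0 < eta -> (forall x, 0 < x < eta -> 0 < f x) -> 0 < E f;
  mean_decay : forall e : R, 0 < e ->
    exists2 t, 0 <= t & E (fun x => expR (- t * x)) < e }.

Definition laplace E A (t : R) := E (fun x => A.[x] * expR (- t * x)).

Lemma tame_linear c f g : tame f -> tame g -> tame (fun x => c * f x + g x).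
Proof.
move=> [cf [p hp]] [cg [q hq]]; split.
  by move=> x; apply: cvgD; [apply: cvgM; [exact: cvg_cst|exact: cf]|exact: cg].
exists (`|c| *: p + q) => x x0; rewrite hornerD hornerZ (le_trans (ler_normD _ _))//.
by rewrite normrM lerD ?ler_wpM2l ?hp ?hq.
Qed.

Definition abs_poly A := \poly_(i < size A) `|A`_i|.

Lemma norm_horner_le A x : 0 < x -> `|A.[x]| <= (abs_poly A).[x].
Proof.
move=> x0; rewrite horner_coef horner_poly (le_trans (ler_norm_sum _ _ _))//.
by apply: ler_sum => i _; rewrite normrM (ger0_norm (exprn_ge0 _ (ltW x0))).
Qed.

Lemma tame_laplace A t : 0 <= t -> tame (fun x => A.[x] * expR (- t * x)).
Proof.
move=> t0; split.
  move=> x; apply: cvgM; first exact: continuous_horner.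
  apply: continuous_comp; last exact: continuous_expR.
  by apply: cvgM; [exact: cvg_cst|exact: cvg_id].
exists (abs_poly A) => x x0; rewrite normrM (ger0_norm (expR_ge0 _)).
rewrite (le_trans _ (norm_horner_le A x0))// ler_piMr//.
by rewrite -expR0 ler_expR mulNr oppr_le0 mulr_ge0// ltW.
Qed.

Lemma tame_exp t : 0 <= t -> tame (fun x => expR (- t * x)).
Proof.
move=> /(tame_laplace 1); congr tame.
by apply/funext => x; rewrite hornerC mul1r.
Qed.

Context {E} (hE : half_line_mean E).
Implicit Types (i j : nat) (t s : R).

Lemma laplace_linear c A B t : 0 <= t ->
  laplace E (c *: A + B) t = c * laplace E A t + laplace E B t.
Proof.
move=> t0; rewrite -(mean_linear hE)//; try exact: tame_laplace.
by congr E; apply/funext => x; rewrite hornerD hornerZ mulrDl mulrA.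
Qed.

Lemma laplace0 t : 0 <= t -> laplace E 0 t = 0.
Proof. by move=> /(laplace_linear (-1) 0 0); rewrite scaler0 addr0 mulN1r addNr. Qed.

Lemma laplaceZ c A t : 0 <= t -> laplace E (c *: A) t = c * laplace E A t.
Proof. by move=> t0; have := laplace_linear c A 0 t0; rewrite laplace0// !addr0. Qed.

Lemma laplaceD A B t : 0 <= t -> laplace E (A + B) t = laplace E A t + laplace E B t.
Proof. by move=> t0; have := laplace_linear 1 A B t0; rewrite scale1r mul1r. Qed.

Lemma laplace_sum (I : Type) (r : seq I) (P : pred I) (F : I -> {poly R}) t : 0 <= t ->
  laplace E (\sum_(i <- r | P i) F i) t = \sum_(i <- r | P i) laplace E (F i) t.
Proof.
move=> t0; elim/big_rec2: _ => [|i y1 y2 _ <-]; first exact: laplace0.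
exact: laplaceD.
Qed.

Lemma laplace_Xn_gt0 i t : 0 <= t -> 0 < laplace E 'X^i t.
Proof.
move=> t0; apply: (@mean_gt0 _ hE _ 1) => //; first exact: tame_laplace.
  by move=> x x0; rewrite hornerXn mulr_ge0 ?expR_ge0// exprn_ge0// ltW.
by move=> x /andP[x0 _]; rewrite hornerXn mulr_gt0 ?expR_gt0// exprn_gt0.
Qed.

Lemma laplace_decr i t s : 0 <= s -> s <= t -> laplace E 'X^i t <= laplace E 'X^i s.
Proof.
move=> s0 st; have t0 := le_trans s0 st.
apply: (mean_le hE); try exact: tame_laplace.
move=> x x0; rewrite hornerXn ler_wpM2l ?exprn_ge0 ?(ltW x0)//.
by rewrite ler_expR !mulNr lerN2 ler_wpM2r// ltW.
Qed.


Lemma mean_scale c f : tame f -> E (fun x => c * f x) = c * E f.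
Proof.
move=> tf; have t0 := tame_laplace 0 (lexx 0).
rewrite -[RHS]addr0 -(laplace0 (lexx 0)) -(mean_linear hE)//.
by congr E; apply/funext => x; rewrite horner0 mul0r addr0.
Qed.

Lemma tame_scale c f : tame f -> tame (fun x => c * f x).
Proof.
move=> tf; have := tame_linear c tf (tame_laplace 0 (lexx 0)).
by congr tame; apply/funext => x; rewrite horner0 mul0r addr0.
Qed.

Lemma mean_exp1 t : laplace E 'X^0 t = E (fun x => expR (- t * x)).
Proof. by congr E; apply/funext => x; rewrite expr0 hornerC mul1r. Qed.

Lemma nbhs_pinfty_expM (a b c : R) : 0 < a -> 0 < b ->
  \forall t \near +oo%R, c * expR (- t * a) <= b.
Proof.
move=> a0 b0; near=> t.
have t1 : 1 <= t by near: t; exact: nbhs_pinfty_ge.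
rewrite mulNr expRN.
have h : t * a <= expR (t * a) by rewrite (le_trans _ (expR_ge1Dx _))// lerDr.
rewrite ler_pdivrMr ?expR_gt0// (le_trans _ (ler_wpM2l (ltW b0) h))//.
have p : 0 < b * a by rewrite mulr_gt0.
rewrite mulrCA -(ler_pdivrMr _ _ p).
by near: t; apply: nbhs_pinfty_ge; exact: num_real.
Unshelve. all: by end_near. Qed.


(** A continuous substitute for [x ^+ i] cut off at [d], bounding the mass near
    0 from below. *)
Lemma mean_ramp_gt0 i (d : R) : 0 < d ->
  tame (fun x => x ^+ i * Num.max 0 (d - x)) /\
  0 < E (fun x => x ^+ i * Num.max 0 (d - x)).
Proof.
move=> d0; have tm : tame (fun x => x ^+ i * Num.max 0 (d - x)).
  split.
    move=> x; apply: cvgM; first exact: exprn_continuous.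
    apply: (@continuous_max _ _ (cst 0) (fun x => d - x)); first exact: cvg_cst.
    by apply: cvgB; [exact: cvg_cst|exact: cvg_id].
  exists ('X^i * d%:P) => x x0.
  rewrite hornerM hornerXn hornerC normrM (ger0_norm (exprn_ge0 _ (ltW x0))).
  rewrite ler_wpM2l ?exprn_ge0 ?(ltW x0)// ger0_norm ?le_max ?lexx//.
  by rewrite ge_max ltW// lerBlDr lerDl ltW.
split=> //; apply: (@mean_gt0 _ hE _ d) => //.
- by move=> x x0; rewrite mulr_ge0 ?exprn_ge0 ?(ltW x0)// le_max lexx.
- by move=> x /andP[x0 x1]; rewrite mulr_gt0 ?exprn_gt0// lt_max subr_gt0 x1 orbT.
Qed.

(** The part of the mass beyond [2 * d] is damped by [expR (- t * (2 * d))],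
    that within [d] only by [expR (- t * d)]. *)
Lemma laplace_XnS_le i (e : R) : 0 < e ->
  \forall t \near +oo%R, laplace E 'X^(i.+1) t <= e * laplace E 'X^i t.
Proof.
move=> e0; pose d := e / 4; have d0 : 0 < d by rewrite divr_gt0.
have [tr] := mean_ramp_gt0 i d0; set r := (fun x => _) in tr *; set m := E r => m0.
near=> t.
have t0 : 0 <= t by near: t; exact: nbhs_pinfty_ge.
have lo : expR (- t * d) * m <= d * laplace E 'X^i t.
  rewrite -laplaceZ// -mean_scale//.
  apply: (mean_le hE); [exact: tame_scale|exact: tame_laplace|].
  move=> x x0; rewrite hornerZ hornerXn /r.
  have xi : 0 <= x ^+ i by rewrite exprn_ge0 ?(ltW x0).
  have [xd|xd] := leP d x.
    by rewrite max_l ?subr_le0// !mulr0 mulr_ge0 ?expR_ge0// mulr_ge0// ltW.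
  rewrite max_r; last by rewrite subr_ge0 ltW.
  have -> : expR (- t * d) * (x ^+ i * (d - x)) = x ^+ i * (expR (- t * d) * (d - x)) by ring.
  have -> : d * x ^+ i * expR (- t * x) = x ^+ i * (expR (- t * x) * d) by ring.
  rewrite ler_wpM2l// ler_pM ?expR_ge0//.
  - by rewrite subr_ge0 ltW.
  - by rewrite ler_expR !mulNr lerN2 ler_wpM2l// ltW.
  - by rewrite lerBlDr lerDl ltW.
have up : laplace E 'X^(i.+1) t <=
    expR (- t * (2 * d)) * laplace E 'X^(i.+1) 0 + 2 * d * laplace E 'X^i t.
  rewrite -(laplaceZ (2 * d))//.
  rewrite /laplace -(mean_linear hE); [|exact: tame_laplace..].
  apply: (mean_le hE); [exact: tame_laplace| |].
    by apply: tame_linear; exact: tame_laplace.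
  move=> x x0; rewrite hornerZ !hornerXn oppr0 mul0r expR0 mulr1.
  have xi k : 0 <= x ^+ k by rewrite exprn_ge0 ?(ltW x0).
  have [xd|xd] := leP (2 * d) x.
    apply: ler_wpDr; first by rewrite mulr_ge0 ?expR_ge0// mulr_ge0// mulr_ge0// ltW.
    rewrite mulrC ler_wpM2r//.
    by rewrite ler_expR !mulNr lerN2 ler_wpM2l.
  apply: ler_wpDl; first by rewrite mulr_ge0 ?expR_ge0.
  rewrite ler_wpM2r ?expR_ge0//; by rewrite exprS ler_wpM2r// ltW.
apply: (le_trans up); have -> : e = 2 * d + 2 * d by rewrite /d; field.
rewrite [leRHS]mulrDl lerD2r.
have -> : - t * (2 * d) = - t * d + - t * d by ring.
have h : (laplace E 'X^(i.+1) 0 / m) * expR (- t * d) <= 2.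
  by near: t; exact: nbhs_pinfty_expM.
have -> : expR (- t * d + - t * d) * laplace E 'X^(i.+1) 0 =
  ((laplace E 'X^(i.+1) 0 / m) * expR (- t * d)) * (expR (- t * d) * m).
  by rewrite expRD; field; rewrite gt_eqF.
have p0 := ltW (laplace_Xn_gt0 i.+1 (lexx 0)).
rewrite -[leRHS]mulrA ler_pM// mulr_ge0 ?expR_ge0 ?(ltW m0)//.
by rewrite divr_ge0// ltW.
Unshelve. all: by end_near. Qed.

(** As [t] grows, the weight [expR (- t * x)] concentrates near [0], so that a
    polynomial factor may be replaced by its value there. *)
Lemma laplace_concentration i A (e : R) : 0 < e ->
  \forall t \near +oo%R,
    `|laplace E ('X^i * A) t - A`_0 * laplace E 'X^i t| <= e * laplace E 'X^i t.
Proof.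
elim/poly_ind: A i e => [|A c IH] i e e0.
  near=> t.
  have t0 : 0 <= t by near: t; exact: nbhs_pinfty_ge.
  rewrite mulr0 laplace0// coef0 mul0r subrr normr0 mulr_ge0 ?(ltW e0)//.
  by rewrite ltW// laplace_Xn_gt0.
pose K := `|A`_0| + 1; have K0 : 0 < K by rewrite ltr_wpDl.
near=> t.
have t0 : 0 <= t by near: t; exact: nbhs_pinfty_ge.
have -> : 'X^i * (A * 'X + c%:P) = c *: 'X^i + 'X^(i.+1) * A.
  by rewrite -mul_polyC exprSr; ring.
rewrite laplace_linear// coefD coefMX coefC add0r [X in `|X|]addrAC subrr add0r.
have h1 : `|laplace E ('X^(i.+1) * A) t - A`_0 * laplace E 'X^(i.+1) t| <=
    1 * laplace E 'X^(i.+1) t.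
  by near: t; apply: IH.
have h2 : laplace E 'X^(i.+1) t <= (e / K) * laplace E 'X^i t.
  by near: t; apply: laplace_XnS_le; rewrite divr_gt0.
have p1 := laplace_Xn_gt0 i.+1 t0.
have -> : e * laplace E 'X^i t = K * ((e / K) * laplace E 'X^i t).
  by field; rewrite gt_eqF.
apply: (le_trans _ (ler_wpM2l (ltW K0) h2)).
rewrite -[X in `|X|](subrK (A`_0 * laplace E 'X^(i.+1) t)) (le_trans (ler_normD _ _))//.
rewrite (normrM (A`_0)) (gtr0_norm p1) /K mulrDl addrC lerD2l.
exact: h1.
Unshelve. all: by end_near. Qed.

Lemma laplace_norm_le i A :
  exists2 C, 0 < C & \forall t \near +oo%R, `|laplace E ('X^i * A) t| <= C * laplace E 'X^i t.
Proof.
exists (`|A`_0| + 1); first by rewrite ltr_wpDl.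
near=> t.
have t0 : 0 <= t by near: t; exact: nbhs_pinfty_ge.
have h : `|laplace E ('X^i * A) t - A`_0 * laplace E 'X^i t| <= 1 * laplace E 'X^i t.
  by near: t; apply: laplace_concentration.
rewrite -[X in `|X|](subrK (A`_0 * laplace E 'X^i t)) (le_trans (ler_normD _ _))//.
by rewrite (normrM (A`_0)) (gtr0_norm (laplace_Xn_gt0 i t0)) mulrDl addrC lerD2l.
Unshelve. all: by end_near. Qed.

Lemma laplace_norm_ge i A : A`_0 != 0 ->
  exists2 C, 0 < C & \forall t \near +oo%R, C * laplace E 'X^i t <= `|laplace E ('X^i * A) t|.
Proof.
move=> A0; exists (`|A`_0| / 2); first by rewrite divr_gt0 ?normr_gt0.
near=> t.
have t0 : 0 <= t by near: t; exact: nbhs_pinfty_ge.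
have h : `|laplace E ('X^i * A) t - A`_0 * laplace E 'X^i t| <=
    `|A`_0| / 2 * laplace E 'X^i t.
  by near: t; apply: laplace_concentration; rewrite divr_gt0 ?normr_gt0.
have p := laplace_Xn_gt0 i t0.
have h' : `|A`_0| * laplace E 'X^i t <=
    `|laplace E ('X^i * A) t| + `|laplace E ('X^i * A) t - A`_0 * laplace E 'X^i t|.
  rewrite -{1}(gtr0_norm p) -normrM distrC.
  by rewrite -{1}[_ * _](subrK (laplace E ('X^i * A) t)) addrC ler_normD.
have e : `|A`_0| / 2 * laplace E 'X^i t + `|A`_0| / 2 * laplace E 'X^i t =
    `|A`_0| * laplace E 'X^i t.
  by field.
by rewrite -(lerD2r (`|A`_0| / 2 * laplace E 'X^i t)) e (le_trans h')// lerD2l.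
Unshelve. all: by end_near. Qed.

End HalfLineMean.
(** * Absence of collapse onto the endpoint *)

Section Endpoint.
Context {R : realType} {E : (R -> R) -> R} (hE : half_line_mean E).
Implicit Types (A B C : {poly R}) (t s x : R).

Lemma factor_Xn A : A != 0 -> exists i B, A = 'X^i * B /\ B`_0 != 0.
Proof.
elim/poly_ind: A => [|A c IH]; first by rewrite eqxx.
have [->|c0] := eqVneq c 0; last first.
  by move=> _; exists 0%N, (A * 'X + c%:P); rewrite mul1r coefD coefMX coefC add0r.
rewrite addr0 mulf_eq0 polyX_eq0 orbF => /IH[i [B [-> B0]]].
by exists i.+1, B; split=> //; rewrite mulrAC -exprSr.
Qed.

(** The terms [(s * x) ^+ a * expR (- s * x)] at the scales [s] = [t],
    [2 * t], ..., closed by a tail exponential.  Each [x > 0] below [1 / t] lies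
    at distance about [1 / s] from 0 for one of these scales, or below all of
    them, where the tail takes over; for larger [x] the first term suffices.  So
    the sum dominates [expR (- t * x)] up to a constant. *)
Fixpoint dyadic_sum a (J : nat) t x : R :=
  if J is J'.+1 then (t * x) ^+ a * expR (- t * x) + dyadic_sum a J' (2 * t) x
  else expR (- t * x).

Lemma dyadic_term_tame a t : 0 <= t -> tame (fun x => (t * x) ^+ a * expR (- t * x)).
Proof.
move=> /(tame_laplace (t ^+ a *: 'X^a)); congr tame; apply/funext => x.
by rewrite hornerZ hornerXn exprMn.
Qed.

Lemma dyadic_sum_tame a J t : 0 <= t -> tame (dyadic_sum a J t).
Proof.
elim: J t => [|J IH] t t0 /=; first exact: tame_exp.
have t2 : 0 <= 2 * t by rewrite mulr_ge0.
have := tame_linear 1 (dyadic_term_tame a t0) (IH _ t2).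
by congr tame; apply/funext => x; rewrite mul1r.
Qed.

Lemma dyadic_sum_ge0 a J t x : 0 <= t * x -> 0 <= dyadic_sum a J t x.
Proof.
elim: J t => [|J IH] t tx /=; first exact: expR_ge0.
by rewrite addr_ge0 ?mulr_ge0 ?expR_ge0 ?exprn_ge0// IH// -mulrA mulr_ge0.
Qed.

Lemma dyadic_sum_ge a J t x : 0 <= t * x <= 2 -> expR (- 2) <= dyadic_sum a J t x.
Proof.
elim: J t => [|J IH] t /andP[z0 z2] /=; first by rewrite ler_expR mulNr lerN2.
have [z1|z1] := leP 1 (t * x).
  apply: ler_wpDr; first by rewrite dyadic_sum_ge0// -mulrA mulr_ge0.
  apply: (@le_trans _ _ (expR (- t * x))); first by rewrite ler_expR mulNr lerN2.
  by rewrite ler_peMl ?expR_ge0// exprn_ege1.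
apply: ler_wpDl; first by rewrite mulr_ge0 ?expR_ge0 ?exprn_ge0.
apply: IH; rewrite -mulrA mulr_ge0//=.
by rewrite -[leRHS]mulr1 ler_wpM2l// ltW.
Qed.

Lemma exp_le_dyadic_sum a J t x : 0 <= t * x ->
  expR (- t * x) <= expR 2 * dyadic_sum a J t x.
Proof.
move=> z0; have [z2|z2] := leP (t * x) 2.
  apply: (@le_trans _ _ 1); first by rewrite -expR0 ler_expR mulNr oppr_le0.
  rewrite -[leLHS]expR0 -(subrr 2) expRD ler_wpM2l ?expR_ge0//.
  by apply: dyadic_sum_ge; rewrite z0.
apply: (@le_trans _ _ (dyadic_sum a J t x)); last first.
  by rewrite ler_peMl ?dyadic_sum_ge0// -expR0 ler_expR.
case: J => [|J] //=; apply: ler_wpDr; first by rewrite dyadic_sum_ge0// -mulrA mulr_ge0.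
by rewrite ler_peMl ?expR_ge0// exprn_ege1// (le_trans _ (ltW z2))// ler1n.
Qed.

(** The bounds at the scales [2 ^+ j * t] form a geometric series, whence the
    factor 2. *)
Lemma mean_dyadic_sum_le a J (T K : R) : 0 < T -> 0 <= K ->
  (forall t, T <= t -> t ^+ a.+1 * laplace E 'X^a t <= K * laplace E 'X^0 t) ->
  forall t, T <= t ->
  E (dyadic_sum a J t) <= 2 * K / t * laplace E 'X^0 t + laplace E 'X^0 (2 ^+ J * t).
Proof.
move=> T0 K0 h; elim: J => [|J IH] t Tt /=; have t0 := lt_le_trans T0 Tt.
  rewrite mul1r mean_exp1 lerDr -mean_exp1 mulr_ge0//.
    by rewrite divr_ge0 ?mulr_ge0// ltW.
  by rewrite ltW// laplace_Xn_gt0// ltW.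
have t2 : 0 <= 2 * t by rewrite mulr_ge0// ltW.
have Tt2 : T <= 2 * t by rewrite (le_trans Tt)// ler_peMl ?(ltW t0)// ler1n.
have td := dyadic_term_tame a (ltW t0).
rewrite (_ : (fun x => _) =
    fun x => 1 * ((t * x) ^+ a * expR (- t * x)) + dyadic_sum a J (2 * t) x); last first.
  by apply/funext => x; rewrite mul1r.
rewrite (mean_linear hE)//; last exact: dyadic_sum_tame.
rewrite mul1r.
have -> : E (fun x => (t * x) ^+ a * expR (- t * x)) = t ^+ a * laplace E 'X^a t.
  rewrite -(laplaceZ hE)// ?ltW//; congr E; apply/funext => x.
  by rewrite hornerZ hornerXn exprMn.
have d0 := laplace_decr hE 0 (ltW t0) (_ : t <= 2 * t).
have {}d0 : laplace E 'X^0 (2 * t) <= laplace E 'X^0 t.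
  by apply: d0; rewrite ler_peMl ?(ltW t0)// ler1n.
have h1 : t ^+ a * laplace E 'X^a t <= K / t * laplace E 'X^0 t.
  rewrite -(ler_pM2l t0) mulrA -exprS [leRHS](_ : _ = K * laplace E 'X^0 t) ?h//.
  by field; rewrite gt_eqF.
have h2 := IH _ Tt2.
have h3 : 2 * K / (2 * t) * laplace E 'X^0 (2 * t) <= K / t * laplace E 'X^0 t.
  have -> : 2 * K / (2 * t) = K / t by field; rewrite gt_eqF.
  by rewrite ler_wpM2l// divr_ge0// ltW.
have -> : 2 ^+ J.+1 * t = 2 ^+ J * (2 * t) by rewrite exprSr mulrA.
have -> : 2 * K / t * laplace E 'X^0 t = K / t * laplace E 'X^0 t + K / t * laplace E 'X^0 t.
  by field; rewrite gt_eqF.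
rewrite -addrA lerD// (le_trans h2)// lerD2r//.
Qed.

(** The mean has no atom at [0], hence its mass cannot lie so close to [0]
    that the moments against [expR (- t * x)] drop by a factor [t ^+ a.+1]:
    summing the assumed bound over the scales [t, 2 * t, 4 * t, ...] would
    bound the whole mass by half of itself plus a tail. *)
Lemma laplace_no_collapse a (K : R) :
  ~ \forall t \near +oo%R, t ^+ a.+1 * laplace E 'X^a t <= K * laplace E 'X^0 t.
Proof.
move=> h.
have K0 : 0 < K.
  have : \forall t \near +oo%R, 0 < t /\ t ^+ a.+1 * laplace E 'X^a t <= K * laplace E 'X^0 t.
    by apply: filterI h; exact: nbhs_pinfty_gt.
  move=> /filter_ex[t [t0]]; have p := laplace_Xn_gt0 hE 0 (ltW t0).
  rewrite -ler_pdivrMr//; apply: lt_le_trans.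
  by rewrite divr_gt0 ?mulr_gt0 ?exprn_gt0// (laplace_Xn_gt0 hE)// ltW.
have [T T0 {}h] : exists2 T, 0 < T &
    forall t, T <= t -> t ^+ a.+1 * laplace E 'X^a t <= K * laplace E 'X^0 t.
  have [M [_ hM]] := h; exists (Num.max 1 (M + 1)); first by rewrite lt_max ltr01.
  by move=> t; rewrite ge_max => /andP[_ Mt]; apply: hM; rewrite (lt_le_trans _ Mt)// ltrDl.
(* at this scale the terms above the tail add up to at most half of the mass *)
pose t := Num.max T (4 * K * expR 2).
have Tt : T <= t by rewrite le_max lexx.
have t0 : 0 < t := lt_le_trans T0 Tt.
have p0 := laplace_Xn_gt0 hE 0 (ltW t0).
pose e := laplace E 'X^0 t / (2 * expR 2).
have e0 : 0 < e by rewrite divr_gt0// mulr_gt0 ?expR_gt0.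
have [s s0 hs] := mean_decay hE e0.
have [J hJ] : exists J : nat, s <= 2 ^+ J * t.
  exists (Num.truncn (s / t)).+1; rewrite -ler_pdivrMr//.
  apply: (@le_trans _ _ (Num.truncn (s / t)).+1%:R).
    by rewrite ltW// truncnS_gt ?divr_ge0 ?(ltW t0).
  by rewrite -natrX ler_nat ltnW// ltn_expl.
have h1 : laplace E 'X^0 t <= expR 2 * E (dyadic_sum a J t).
  rewrite mean_exp1 -(mean_scale hE); last by apply: dyadic_sum_tame; exact: ltW.
  apply: (mean_le hE); [exact: tame_exp (ltW t0)| |].
    by apply: tame_scale; apply: dyadic_sum_tame; exact: ltW.
  by move=> x x0; apply: exp_le_dyadic_sum; rewrite mulr_ge0 ?ltW.
have h2 := mean_dyadic_sum_le J T0 (ltW K0) h Tt.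
have h3 : laplace E 'X^0 (2 ^+ J * t) < e.
  by rewrite (le_lt_trans (laplace_decr hE 0 s0 hJ))// mean_exp1.
have h4 : expR 2 * (2 * K / t * laplace E 'X^0 t) <= laplace E 'X^0 t / 2.
  have : 4 * K * expR 2 / t <= 1.
    by rewrite ler_pdivrMr// mul1r le_max lexx orbT.
  move=> /(ler_wpM2r (ltW (divr_gt0 p0 (ltr0Sn _ 1)))); rewrite mul1r; apply: le_trans.
  by rewrite le_eqVlt; apply/orP; left; apply/eqP; field; rewrite gt_eqF.
have h5 : expR 2 * e = laplace E 'X^0 t / 2.
  by rewrite /e; field; rewrite gt_eqF ?expR_gt0.
suff : laplace E 'X^0 t < laplace E 'X^0 t by rewrite ltxx.
apply: (le_lt_trans h1); apply: (le_lt_trans (ler_wpM2l (expR_ge0 2) h2)).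
rewrite mulrDr [ltRHS](_ : _ = laplace E 'X^0 t / 2 + laplace E 'X^0 t / 2); last by field.
by rewrite ler_ltD// -h5 ltr_pM2l ?expR_gt0.
Unshelve. all: by end_near. Qed.

End Endpoint.
(** * Orders of vanishing at an endpoint *)

Section EndpointTheorem.
Context {R : realType} {E : (R -> R) -> R} (hE : half_line_mean E).
Context (n : nat) (A : nat -> {poly R}).
Implicit Types (B C : {poly R}) (t s x : R).

(** Self-adjointness tested on [expR (- s * x)] and [expR (- t * x)], where
    [A k] is the coefficient of the [k]-th derivative. *)
Definition exp_symmetric := forall s t, 0 <= s -> 0 <= t ->
  \sum_(1 <= k < n.+1) (- s) ^+ k * laplace E (A k) (s + t) =
  \sum_(1 <= k < n.+1) (- t) ^+ k * laplace E (A k) (s + t).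

(** The mean of [L y * u] for [y = expR (- (z * t) * x)] and
    [u = expR (- ((1 - z) * t) * x)], as a polynomial in [z]. *)
Definition exp_symbol t : {poly R} :=
  \poly_(k < n.+1) (if (0 < k)%N then (- t) ^+ k * laplace E (A k) t else 0).

Lemma exp_symbol_horner t z :
  (exp_symbol t).[z] = \sum_(1 <= k < n.+1) (- (z * t)) ^+ k * laplace E (A k) t.
Proof.
rewrite horner_poly -(big_mkord xpredT (fun k =>
  (if (0 < k)%N then (- t) ^+ k * laplace E (A k) t else 0) * z ^+ k)).
rewrite big_nat_recl//= mul0r add0r big_add1; apply: eq_bigr => k _ /=.
by rewrite -mulrN exprMn; ring.
Qed.

Lemma exp_symbol_invariant t : (0 < n)%N -> exp_symmetric -> 0 < t ->
  reflection_invariant (exp_symbol t).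
Proof.
move=> n0 sA t0; apply: (@reflection_invariant_grid _ _ n) => //; first exact: size_poly.
move=> i le_in; rewrite !exp_symbol_horner.
have nR : n%:R != 0 :> R by rewrite pnatr_eq0 -lt0n.
have h (j : nat) : 0 <= j%:R / n%:R * t by rewrite mulr_ge0 ?(ltW t0)// divr_ge0.
have := sA _ _ (h i) (h (n - i)%N).
have -> // : i%:R / n%:R * t + (n - i)%:R / n%:R * t = t.
by rewrite natrB// -!mulrDl addrC subrK divff// mul1r.
Qed.

Lemma coef_exp_symbol t k : (0 < k <= n)%N ->
  (exp_symbol t)`_k = (- t) ^+ k * laplace E (A k) t.
Proof. by move=> /andP[k0 kn]; rewrite coef_poly ltnS kn k0. Qed.

Lemma laplace_norm_le_uniform N :
  exists2 K, 0 < K & \forall t \near +oo%R,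
    forall k, (k < N)%N -> `|laplace E (A k) t| <= K * laplace E 'X^0 t.
Proof.
elim: N => [|N [K K0 IH]]; first by exists 1 => //; near=> t.
have [C C0 hC] := laplace_norm_le hE 0 (A N); exists (K + C); first exact: addr_gt0.
near=> t; have t0 : 0 <= t by near: t; exact: nbhs_pinfty_ge.
have p := laplace_Xn_gt0 hE 0 t0.
have hK : forall k, (k < N)%N -> `|laplace E (A k) t| <= K * laplace E 'X^0 t by near: t.
have hN : `|laplace E ('X^0 * A N) t| <= C * laplace E 'X^0 t by near: t.
move=> k; rewrite ltnS leq_eqVlt mulrDl => /orP[/eqP ->|/hK h].
  by rewrite -[A N]mul1r ler_wpDl// mulr_ge0 ?ltW.
by rewrite ler_wpDr// mulr_ge0 ?ltW.
Unshelve. all: by end_near. Qed.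

(** Below, [pearson] is the relation between the two leading coefficients of
    the symbol, an integrated form of [n * (p * a n)^`() = 2 * p * a n.-1], and
    [low] bounds the leading coefficient by the lower half of the others. *)
Lemma endpoint_order : (2 < n)%N -> A n != 0 -> exp_symmetric ->
  exists2 m, n = m.*2 & forall a B, A n = 'X^a * B -> B`_0 != 0 ->
    (m <= a)%N /\ exists b C, [/\ A n.-1 = 'X^b * C, C`_0 != 0 & (0 < b < a)%N].
Proof.
move=> n2 An0 sA; have n0 : (0 < n)%N by apply: leq_trans n2.
have nn : n.-1.+1 = n by rewrite prednK.
have szG t : (size (exp_symbol t) <= n.+1)%N by exact: size_poly.
have top a B : A n = 'X^a * B -> B`_0 != 0 ->
    exists2 c, 0 < c & \forall t \near +oo%R,
      [/\ 1 <= t, c * laplace E 'X^a t <= `|laplace E (A n) t| & laplace E (A n) t != 0].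
  move=> e B0; have [c c0 hc] := laplace_norm_ge hE a B0; exists c => //.
  rewrite e; near=> t; have t1 : 1 <= t by near: t; exact: nbhs_pinfty_ge.
  have hct : c * laplace E 'X^a t <= `|laplace E ('X^a * B) t| by near: t.
  split => //; rewrite -normr_gt0 (lt_le_trans _ hct)// mulr_gt0//.
  by rewrite (laplace_Xn_gt0 hE)// (le_trans _ t1).
have en : ~~ odd n.
  have [a [B [eA B0]]] := factor_Xn An0; have [c c0 /filter_ex[t [t1 _ nz]]] := top _ _ eA B0.
  have t0 : 0 < t by rewrite (lt_le_trans _ t1).
  apply: (reflection_invariant_even (exp_symbol_invariant n0 sA t0) (szG t)).
  by rewrite coef_exp_symbol ?n0 ?leqnn// mulf_neq0// expf_neq0// oppr_eq0 gt_eqF.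
exists n./2; first by rewrite -[LHS](odd_double_half n) (negbTE en).
set m := n./2; have nm : n = m.*2 by rewrite -[LHS](odd_double_half n) (negbTE en).
have m1 : (1 < m)%N by rewrite -ltn_double -nm.
move=> a B eA B0; have [c c0 hc] := top _ _ eA B0.
have pearson : \forall t \near +oo%R,
    laplace E (A n.-1) t *+ 2 = n%:R * t * laplace E (A n) t.
  near=> t; have [t1 _ nz] : [/\ 1 <= t, c * laplace E 'X^a t <= `|laplace E (A n) t|
    & laplace E (A n) t != 0] by near: t.
  have t0 : 0 < t by rewrite (lt_le_trans _ t1).
  have tn : - t != 0 by rewrite oppr_eq0 gt_eqF.
  have := @reflection_invariant_coef_pred _ (exp_symbol t) n.-1 (exp_symbol_invariant n0 sA t0).
  have n1 : (0 < n.-1 <= n)%N by rewrite leq_pred andbT -subn1 subn_gt0 (ltnW n2).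
  rewrite nn => /(_ (szG t)); rewrite !coef_exp_symbol// ?n0 ?leqnn//.
  move=> /(_ (mulf_neq0 (expf_neq0 _ tn) nz)).
  have -> : (- t) ^+ n = - t * (- t) ^+ n.-1 by rewrite -exprS nn.
  rewrite -mulrnAr => e; apply: (mulfI (expf_neq0 n.-1 tn)); rewrite e; ring.
have low : exists2 K, 0 < K & \forall t \near +oo%R,
    t ^+ n * `|laplace E (A n) t| <= K * t ^+ m * laplace E 'X^0 t.
  have [C C0 hC] := laplace_norm_le_uniform m.+1.
  exists (m`!%:R * m.+1%:R * C); first by rewrite !mulr_gt0// ltr0n fact_gt0.
  near=> t; have t1 : 1 <= t by near: t; exact: nbhs_pinfty_ge.
  have t0 : 0 < t by rewrite (lt_le_trans _ t1).
  have p := laplace_Xn_gt0 hE 0 (ltW t0).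
  have hk : forall k, (k < m.+1)%N -> `|laplace E (A k) t| <= C * laplace E 'X^0 t by near: t.
  have := reflection_invariant_lead_le (exp_symbol_invariant n0 sA t0).
  move=> /(_ m); rewrite -nm => /(_ (szG t)).
  rewrite coef_exp_symbol ?n0 ?leqnn// normrM normrX normrN (gtr0_norm t0) => h.
  apply: (le_trans h); rewrite -!mulrA ler_wpM2l//.
  rewrite mulr_natl -[X in _ *+ X](card_ord m.+1) -sumr_const ler_sum// => k _.
  have [k0|k0] := posnP k.
    by rewrite coef_poly k0 normr0 !mulr_ge0// ?exprn_ge0 ?ltW.
  rewrite coef_exp_symbol; last first.
    by rewrite k0 /= nm -addnn (leq_trans _ (leq_addr m m))// -ltnS.
  rewrite normrM normrX normrN (gtr0_norm t0) mulrCA ler_pM ?exprn_ge0 ?(ltW t0)//.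
    by rewrite ler_weXn2l// -ltnS.
  exact: hk.
have [K K0 hK] := low.
(* for a < m the bound would make the mass collapse onto 0, as a.+1 <= n - m *)
have m_le : (m <= a)%N.
  rewrite leqNgt; apply/negP => am; apply: (@laplace_no_collapse _ _ hE a (K / c)).
  near=> t; have [t1 hct _] : [/\ 1 <= t, c * laplace E 'X^a t <= `|laplace E (A n) t|
    & laplace E (A n) t != 0] by near: t.
  have hKt : t ^+ n * `|laplace E (A n) t| <= K * t ^+ m * laplace E 'X^0 t by near: t.
  have t0 : 0 < t by rewrite (lt_le_trans _ t1).
  have p := laplace_Xn_gt0 hE a (ltW t0).
  rewrite -(ler_pM2l c0) -(ler_pM2l (exprn_gt0 m t0)).
  have -> : t ^+ m * (c * (K / c * laplace E 'X^0 t)) = K * t ^+ m * laplace E 'X^0 t.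
    by field; rewrite gt_eqF.
  apply: le_trans hKt; rewrite [c * _]mulrCA !mulrA -exprD -mulrA ler_pM ?exprn_ge0 ?(ltW t0)//.
    by rewrite mulr_ge0 ?ltW.
  by rewrite ler_weXn2l// nm -addnn leq_add2l.
split=> //.
have A1 : A n.-1 != 0.
  apply/eqP => e0.
  have [t [[t1 _ nz]]] := filter_ex (filterI hc pearson).
  have t0 : 0 < t by rewrite (lt_le_trans _ t1).
  rewrite e0 (laplace0 hE) ?(ltW t0)// mul0rn => /esym/eqP.
  by rewrite !mulf_eq0 (negbTE nz) (gt_eqF t0) pnatr_eq0 -[n == 0%N]negbK -lt0n n0.
have [b [C [eb C0]]] := factor_Xn A1; exists b, C; split=> //; apply/andP; split.
  (* b = 0 gives t ^+ n.-1 <= K * t ^+ m for large t, while n.-1 > m *)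
  rewrite lt0n; apply/eqP => b0; rewrite b0 in eb.
  have [d d0 hd] := laplace_norm_ge hE 0 C0; rewrite -eb in hd.
  have big := nbhs_pinfty_gt (num_real (n%:R * K / (d * 2))).
  have [t [[[hKt hdt] hp] [{}big t1]]] :=
    filter_ex (filterI (filterI (filterI hK hd) pearson)
                       (filterI big (nbhs_pinfty_ge (num_real 1)))).
  have t0 : 0 < t by rewrite (lt_le_trans _ t1).
    have p := laplace_Xn_gt0 hE 0 (ltW t0).
    have {}hp : `|laplace E (A n.-1) t| * 2 = n%:R * t * `|laplace E (A n) t|.
      by move/(congr1 Num.norm): hp; rewrite normrMn !normrM (gtr0_norm t0) normr_nat mulr_natr.
    have h1 : d * laplace E 'X^0 t * 2 <= n%:R * t * `|laplace E (A n) t|.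
      by rewrite -hp ler_wpM2r.
    have h2 : t ^+ m * t * (d * 2) * laplace E 'X^0 t <= n%:R * K * t ^+ m * laplace E 'X^0 t.
      apply: (@le_trans _ _ (n%:R * (t ^+ n * `|laplace E (A n) t|))); last first.
        by rewrite -!mulrA ler_wpM2l// mulrA.
      have -> : n%:R * (t ^+ n * `|laplace E (A n) t|) =
          t ^+ n.-1 * (n%:R * t * `|laplace E (A n) t|).
        by rewrite -{2}nn exprS; ring.
      rewrite -exprSr [leLHS](_ : _ = t ^+ m.+1 * (d * laplace E 'X^0 t * 2)); last by ring.
      rewrite ler_pM ?exprn_ge0 ?(ltW t0)//; first by rewrite !mulr_ge0 ?ltW.
      by rewrite ler_weXn2l// -ltnS nn nm -addnn -(addn2 m) leq_add2l.
    move: h2; rewrite ler_pM2r// mulrAC -mulrA [leRHS]mulrC ler_pM2l ?exprn_gt0//.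
    by rewrite -ler_pdivlMl ?mulr_gt0// mulrC leNgt big.
(* b >= a bounds t * laplace E 'X^a t by a multiple of laplace E 'X^a t *)
rewrite ltnNge; apply/negP => ab.
have [d d0] := laplace_norm_le hE a ('X^(b - a) * C).
rewrite mulrA -exprD subnKC// -eb => hd.
have big := nbhs_pinfty_gt (num_real (d * 2 / (n%:R * c))).
have [t [[[[t1 hct _] hdt] hp] {}big]] :=
  filter_ex (filterI (filterI (filterI hc hd) pearson) big).
have t0 : 0 < t by rewrite (lt_le_trans _ t1).
  have p := laplace_Xn_gt0 hE a (ltW t0).
  have {}hp : `|laplace E (A n.-1) t| * 2 = n%:R * t * `|laplace E (A n) t|.
    by move/(congr1 Num.norm): hp; rewrite normrMn !normrM (gtr0_norm t0) normr_nat mulr_natr.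
  have : n%:R * c * t * laplace E 'X^a t <= d * 2 * laplace E 'X^a t.
    apply: (@le_trans _ _ (`|laplace E (A n.-1) t| * 2)).
      rewrite hp [leLHS](_ : _ = n%:R * t * (c * laplace E 'X^a t)); last by ring.
      by rewrite ler_wpM2l// mulr_ge0// ltW.
    by rewrite [leRHS]mulrAC ler_wpM2r.
  by rewrite ler_pM2r// -ler_pdivlMl ?mulr_gt0 ?ltr0n// mulrC leNgt big.
Unshelve. all: by end_near. Qed.

End EndpointTheorem.
(** * Growth of moments on an unbounded interval *)

Section Infinity.
Context {R : realType} {E : (R -> R) -> R} (hE : half_line_mean E).
Hypothesis far : forall f K, tame f -> (forall x, 0 < x -> 0 <= f x) ->
  (forall x, K < x -> 0 < f x) -> 0 < E f.
Implicit Types (A B C : {poly R}) (i j k d M N : nat).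

Definition moment A := laplace E A 0.

Lemma moment_Xn_gt0 N : 0 < moment 'X^N.
Proof. exact: laplace_Xn_gt0. Qed.
#[local] Hint Resolve moment_Xn_gt0 : core.
#[local] Hint Extern 0 (is_true (0 <= moment 'X^_)) => exact: ltW : core.

(** Mass beyond [2 * L] makes the moments grow like [(2 * L) ^+ N] at least,
    while the part of the mass below [L] contributes [L ^+ N] at most. *)
Lemma moment_growth (K : R) : 0 < K ->
  \forall N \near \oo, K * moment 'X^N <= moment 'X^(N.+1).
Proof.
move=> K0; have [L LK] : exists L, 2 * K = L by exists (2 * K).
have L0 : 0 < L by rewrite -LK mulr_gt0.
have L2 : 0 <= 2 * L by rewrite mulr_ge0// ltW.
pose r x := Num.max 0 (x - 2 * L).
have tr : tame r.
  split.
    move=> x; apply: (@continuous_max _ _ (cst 0) (fun x => x - 2 * L)); first exact: cvg_cst.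
    by apply: cvgB; [exact: cvg_id|exact: cvg_cst].
  exists 'X => x x0; rewrite hornerX ger0_norm ?le_max ?lexx//.
  by rewrite ge_max ltW// lerBlDr lerDl.
have m0 : 0 < E r.
  apply: (@far _ (2 * L)) => //; first by move=> x _; rewrite le_max lexx.
  by move=> x xL; rewrite lt_max subr_gt0 xL orbT.
have tm N : tame (fun x : R => x ^+ N).
  rewrite (_ : (fun x => _) = (fun x => 'X^N.[x] * expR (- 0 * x))).
    exact: tame_laplace.
  by apply/funext => x; rewrite hornerXn oppr0 mul0r expR0 mulr1.
have momE N : moment 'X^N = E (fun x : R => x ^+ N).
  by congr E; apply/funext => x; rewrite hornerXn oppr0 mul0r expR0 mulr1.
near=> N.
have lo : (2 * L) ^+ N * E r <= moment 'X^(N.+1).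
  rewrite momE -mean_scale//; apply: (mean_le hE) => //; first exact: tame_scale.
  move=> x x0; rewrite /r; have [xL|xL] := leP (x - 2 * L) 0.
    by rewrite mulr0 exprn_ge0// ltW.
  have h : 2 * L <= x by rewrite -subr_ge0 ltW.
  rewrite exprSr ler_pM ?(exprn_ge0 _ L2) ?(ltW xL)//.
    by rewrite lerXn2r ?nnegrE ?L2// ltW.
  by rewrite lerBlDr lerDl.
have up : K * moment 'X^N <= 2^-1 * moment 'X^(N.+1) + K * L ^+ N * moment 'X^0.
  rewrite !momE -mean_scale// -(mean_scale hE (K * L ^+ N))// -(mean_linear hE)//; last exact: tame_scale.
  apply: (mean_le hE); [exact: tame_scale|by apply: tame_linear => //; exact: tame_scale|].
  move=> x x0; rewrite expr0 mulr1; have [xL|xL] := leP L x.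
    apply: ler_wpDr; first by rewrite mulr_ge0 ?exprn_ge0 ?ltW.
    rewrite exprS mulrA ler_wpM2r ?exprn_ge0 ?(ltW x0)//.
    by rewrite ler_pdivlMl// LK.
  apply: ler_wpDl; first by rewrite mulr_ge0 ?exprn_ge0 ?(ltW x0).
  by rewrite ler_wpM2l ?(ltW K0)// lerXn2r ?nnegrE ?ltW.
apply: (le_trans up).
rewrite -[leRHS]mul1r [X in _ <= X * _](_ : _ = 2^-1 + 2^-1); last by field.
rewrite mulrDl lerD2l.
have h : 2 * K * moment 'X^0 / E r <= N%:R.
  by near: N; exact: nbhs_infty_ger.
have h2 : N%:R <= 2 ^+ N :> R by rewrite -natrX ler_nat ltnW// ltn_expl.
rewrite ler_pdivlMl// (le_trans _ lo)// exprMn mulrA.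
have -> : 2 * (K * L ^+ N) * moment 'X^0 = (2 * K * moment 'X^0 / E r) * (L ^+ N * E r).
  by field; rewrite gt_eqF.
rewrite -[leRHS]mulrA ler_wpM2r ?mulr_ge0 ?exprn_ge0 ?(ltW L0) ?(ltW m0)//.
exact: le_trans h2.
Unshelve. all: by end_near. Qed.

Lemma moment_nondecr d : \forall N \near \oo, forall i, (i <= d)%N ->
  moment 'X^(N + i) <= moment 'X^(N + d).
Proof.
have [N0 _ h] := moment_growth (@ltr01 R).
exists N0 => // N /= hN i; elim: d => [|d IH]; first by rewrite leqn0 => /eqP->.
rewrite leq_eqVlt => /orP[/eqP->//|/IH le1]; apply: (le_trans le1).
by rewrite addnS -[leLHS]mul1r; apply: h; rewrite /= (leq_trans hN) ?leq_addr.
Qed.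

Lemma moment_norm_le A d : (size A <= d.+1)%N ->
  exists2 C, 0 < C & \forall N \near \oo, `|moment (A * 'X^N)| <= C * moment 'X^(N + d).
Proof.
move=> sA; exists (1 + \sum_(i < size A) `|A`_i|).
  by rewrite ltr_pwDl// sumr_ge0.
near=> N; have h : forall i, (i <= d)%N -> moment 'X^(N + i) <= moment 'X^(N + d).
  by near: N; exact: moment_nondecr.
rewrite mulrDl mul1r ler_wpDl// mulr_suml.
rewrite {1}[A](_ : _ = \sum_(i < size A) A`_i *: 'X^i); last by rewrite -poly_def coefK.
rewrite mulr_suml /moment (laplace_sum hE)// (le_trans (ler_norm_sum _ _ _))//.
apply: ler_sum => i _; rewrite -scalerAl -exprD (laplaceZ hE)// normrM.
rewrite ler_wpM2l// gtr0_norm; last exact: moment_Xn_gt0.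
by rewrite addnC; apply: h; rewrite -ltnS (leq_trans _ sA).
Unshelve. all: by end_near. Qed.

Lemma moment_norm_small A d (e : R) : 0 < e -> (size A <= d)%N ->
  \forall N \near \oo, `|moment (A * 'X^N)| <= e * moment 'X^(N + d).
Proof.
move=> e0; case: d => [|d] sA.
  move: sA; rewrite leqn0 size_poly_eq0 => /eqP ->; near=> N.
  by rewrite mul0r {1}/moment (laplace0 hE)// normr0 mulr_ge0 ?(ltW e0)// ltW.
have [C C0 hC] := moment_norm_le sA.
have [N0 _ hg] := moment_growth (divr_gt0 C0 e0).
near=> N; have h1 : `|moment (A * 'X^N)| <= C * moment 'X^(N + d) by near: N.
have h2 : (N0 <= N)%N by near: N; exact: nbhs_infty_ge.
apply: (le_trans h1); rewrite addnS.
have := hg (N + d)%N (leq_trans h2 (leq_addr _ _)).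
by rewrite mulrAC ler_pdivrMr// => /le_trans; apply; rewrite mulrC.
Unshelve. all: by end_near. Qed.

(** High moments only see the leading term of a polynomial factor. *)
Lemma moment_norm_ge A d : size A = d.+1 ->
  exists2 c, 0 < c & \forall N \near \oo, c * moment 'X^(N + d) <= `|moment (A * 'X^N)|.
Proof.
move=> sA; have l0 : A`_d != 0.
  by rewrite -[d]/(d.+1.-1) -sA -lead_coefE lead_coef_eq0 -size_poly_eq0 sA.
pose B := A - A`_d *: 'X^d.
have sB : (size B <= d)%N.
  apply/leq_sizeP => j; rewrite leq_eqVlt coefB coefZ coefXn => /orP[/eqP <-|dj].
    by rewrite eqxx mulr1 subrr.
  by rewrite gtn_eqF// mulr0 subr0 nth_default// sA.
exists (`|A`_d| / 2); first by rewrite divr_gt0 ?normr_gt0.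
near=> N.
have h : `|moment (B * 'X^N)| <= `|A`_d| / 2 * moment 'X^(N + d).
  by near: N; apply: moment_norm_small => //; rewrite divr_gt0 ?normr_gt0.
have e : moment (B * 'X^N) = moment (A * 'X^N) - A`_d * moment 'X^(N + d).
  rewrite /B mulrBl -scalerAl -exprD addnC addrC -scaleNr [in LHS]/moment (laplace_linear hE)//.
  by rewrite mulNr addrC.
have p := moment_Xn_gt0 (N + d).
have h' : `|A`_d| * moment 'X^(N + d) <= `|moment (A * 'X^N)| + `|moment (B * 'X^N)|.
  rewrite -{1}(gtr0_norm p) -normrM e distrC.
  by rewrite -{1}[_ * _](subrK (moment (A * 'X^N))) addrC ler_normD.
have e2 : `|A`_d| / 2 * moment 'X^(N + d) + `|A`_d| / 2 * moment 'X^(N + d) =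
    `|A`_d| * moment 'X^(N + d).
  by field.
by rewrite -(lerD2r (`|A`_d| / 2 * moment 'X^(N + d))) e2 (le_trans h')// lerD2l.
Unshelve. all: by end_near. Qed.

End Infinity.
(** * The degree on an unbounded interval *)

Section InfinityTheorem.
Context {R : realType} {E : (R -> R) -> R} (hE : half_line_mean E).
Hypothesis far : forall f K, tame f -> (forall x, 0 < x -> 0 <= f x) ->
  (forall x, K < x -> 0 < f x) -> 0 < E f.
Context (n : nat) (A : nat -> {poly R}).
Implicit Types (B C : {poly R}) (i j k d M N : nat).
Local Notation mom := (@moment R E).

(** [ffact_poly k] interpolates the falling factorials [i ^_ k]. *)
Definition ffact_poly k : {poly R} := \prod_(l <- iota 0 k) ('X - l%:R%:P).

Lemma size_ffact_poly k : size (ffact_poly k) = k.+1.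
Proof. by rewrite size_prod_XsubC size_iota. Qed.

Lemma ffact_poly_lead k : (ffact_poly k)`_k = 1.
Proof.
have := monic_prod_XsubC (iota 0 k) xpredT (fun l => l%:R : R).
by rewrite -/(ffact_poly k) monicE lead_coefE size_ffact_poly => /eqP.
Qed.

Lemma ffact_poly_horner k i : (ffact_poly k).[i%:R] = (i ^_ k)%:R.
Proof.
elim: k => [|k IH]; first by rewrite /ffact_poly big_nil hornerC.
rewrite /ffact_poly -[k.+1]addn1 iotaD big_cat big_seq1 hornerM IH add0n.
rewrite addn1 ffactnSr natrM !hornerE; have [ki|ik] := leqP k i.
  by rewrite natrB.
by rewrite ffact_small// !mul0r.
Qed.

(** Self-adjointness tested on [x ^+ i] and [x ^+ j].  For [k > i + j] the
    truncated exponent is harmless, as the falling factorials vanish. *)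
Definition power_symmetric := forall i j,
  \sum_(1 <= k < n.+1) (i ^_ k)%:R * mom (A k * 'X^(i + j - k)) =
  \sum_(1 <= k < n.+1) (j ^_ k)%:R * mom (A k * 'X^(i + j - k)).

(** The mean of [L (x ^+ i) * x ^+ (N - i)], as a polynomial in [z = i / N]. *)
Definition power_symbol N : {poly R} :=
  \sum_(1 <= k < n.+1)
    mom (A k * 'X^(N - k)) *: \poly_(j < k.+1) ((ffact_poly k)`_j * N%:R ^+ j).

Lemma power_symbol_horner N i : (0 < N)%N -> (power_symbol N).[i%:R / N%:R] =
  \sum_(1 <= k < n.+1) (i ^_ k)%:R * mom (A k * 'X^(N - k)).
Proof.
move=> N0; rewrite horner_sum; apply: eq_bigr => k _.
rewrite hornerZ mulrC -ffact_poly_horner horner_poly horner_coef size_ffact_poly.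
congr (_ * _); apply: eq_bigr => j _; rewrite -mulrA -exprMn.
by rewrite mulrCA divff ?mulr1// pnatr_eq0 -lt0n.
Qed.

Lemma size_power_symbol N : (size (power_symbol N) <= n.+1)%N.
Proof.
apply: (leq_trans (size_sum _ _ _)); apply/bigmax_leqP_seq => k.
rewrite mem_index_iota => /andP[_ kn] _.
by rewrite (leq_trans (size_scale_leq _ _))// (leq_trans (size_poly _ _)).
Qed.

Lemma power_symbol_invariant N : (0 < N)%N -> (n <= N)%N -> power_symmetric ->
  reflection_invariant (power_symbol N).
Proof.
move=> N0 nN sA; apply: (@reflection_invariant_grid _ _ N) => //.
  by rewrite (leq_trans (size_power_symbol N)).
move=> i iN; rewrite !power_symbol_horner//.
by have := sA i (N - i)%N; rewrite subnKC.
Qed.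

Lemma coef_power_symbol N j : (power_symbol N)`_j =
  \sum_(1 <= k < n.+1) (ffact_poly k)`_j * N%:R ^+ j * mom (A k * 'X^(N - k)).
Proof.
rewrite coef_sum; apply: eq_bigr => k _; rewrite coefZ coef_poly ltnS mulrC.
by case: leqP => // kj; rewrite nth_default ?size_ffact_poly// !mul0r.
Qed.

(** With sigma_M the [M]-th moment and [d] the degree of [A n], the bound on the
    leading coefficient of the symbol reads
    N^n sigma_(N - n + d) <= K N^m sigma_N.  The relation between its two leading
    coefficients shows that consecutive moments have a ratio of order at most
    [N], so that the right side is at most of order
    N^(m + n - d) sigma_(N - n + d), whence [d <= m].  The proof is written in
    [M = N - n]. *)
Lemma infinity_order m : n = m.*2 -> (1 < m)%N ->
  (forall k, (1 <= k <= n)%N -> (size (A k) <= k.+1)%N) -> A n != 0 ->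
  power_symmetric -> (size (A n) <= m.+1)%N.
Proof.
move=> nm m1 sz An0 sA.
have n0 : (0 < n)%N by rewrite nm double_gt0 ltnW.
have nn : n.-1.+1 = n by rewrite prednK.
have [d sd] : exists d, size (A n) = d.+1.
  by exists (size (A n)).-1; rewrite prednK// lt0n size_poly_eq0.
have dn : (d <= n)%N by rewrite -ltnS -sd sz// n0 leqnn.
have [c c0 hc] := moment_norm_ge hE far sd.
pose N M := (M + n)%N.
pose L M := mom (A n * 'X^M).
have gn M : (power_symbol (N M))`_n = (N M)%:R ^+ n * L M.
  rewrite coef_power_symbol big_nat_recr//= big1_seq ?add0r.
    by rewrite ffact_poly_lead mul1r addnK.
  move=> k; rewrite mem_index_iota => /andP[_ /andP[_ kn]].
  by rewrite nth_default ?size_ffact_poly// !mul0r.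
have n1 : (0 < n.-1)%N by rewrite -subn1 subn_gt0 nm -addnn ltn_addl// ltnW.
pose s := (ffact_poly n)`_n.-1.
have gn1 M : (power_symbol (N M))`_n.-1 =
    (N M)%:R ^+ n.-1 * (mom (A n.-1 * 'X * 'X^M) + s * L M).
  rewrite coef_power_symbol big_nat_recr//= addnK.
  rewrite (_ : \sum_(1 <= i < n) _ = (N M)%:R ^+ n.-1 * mom (A n.-1 * 'X * 'X^M)).
    by rewrite /s /L; ring.
  rewrite -[X in index_iota _ X]nn big_nat_recr//= big1_seq ?add0r.
    rewrite ffact_poly_lead mul1r -mulrA -exprS /N -subn1 subnBA// addn1.
    by rewrite -[(M + n).+1]addSn addnK.
  move=> k; rewrite mem_index_iota => /andP[_ /andP[_ kn]].
  by rewrite nth_default ?size_ffact_poly// !mul0r.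
have pearson M : (0 < M)%N -> L M != 0 ->
    mom (A n.-1 * 'X * 'X^M) *+ 2 = - (n%:R * (N M)%:R + s *+ 2) * L M.
  move=> M0 LM; have N0 : (0 < N M)%N by rewrite addn_gt0 M0.
  have NR : (N M)%:R != 0 :> R by rewrite pnatr_eq0 -lt0n.
  have := @reflection_invariant_coef_pred _ (power_symbol (N M)) n.-1.
  rewrite nn => /(_ (power_symbol_invariant N0 (leq_addl _ _) sA) (size_power_symbol _)).
  rewrite gn gn1 => /(_ (mulf_neq0 (expf_neq0 _ NR) LM)).
  have -> : (N M)%:R ^+ n = (N M)%:R * (N M)%:R ^+ n.-1 :> R by rewrite -exprS nn.
  rewrite -mulrnAr => e; apply: (addIr (s * L M *+ 2)).
  by apply: (mulfI (expf_neq0 n.-1 NR)); rewrite -mulrnDl e; ring.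
have pearson_norm M : (0 < M)%N -> L M != 0 ->
    `|mom (A n.-1 * 'X * 'X^M)| * 2 = `|n%:R * (N M)%:R + s *+ 2| * `|L M|.
  by move=> M0 LM; rewrite mulr_natr -normrMn pearson// normrM normrN.
have N_large (K : R) : \forall M \near \oo, K <= (N M)%:R.
  near=> M; apply: (@le_trans _ _ M%:R); last by rewrite ler_nat leq_addr.
  by near: M; exact: nbhs_infty_ger.
have L_ne0 M : c * mom 'X^(M + d) <= `|L M| -> L M != 0.
  move=> h; rewrite -normr_gt0 (lt_le_trans _ h)// mulr_gt0//.
  exact: moment_Xn_gt0.
pose S := `|s|; have S0 : 0 <= S by exact: normr_ge0.
have S2 : 0 <= S *+ 2 by rewrite mulrn_wge0.
(* a degree of A n.-1 below that of A n would contradict pearson for large M *)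
have ratio : exists2 C, 0 < C & \forall M \near \oo,
    mom 'X^((M + d).+1) <= C * (N M)%:R * mom 'X^(M + d).
  have [sB|sB] := leqP (size (A n.-1 * 'X)) d.+1.
    have [C C0 hC] := moment_norm_le hE far sB.
    exists 1 => //; near=> M.
    have hCM : `|mom (A n.-1 * 'X * 'X^M)| <= C * mom 'X^(M + d) by near: M.
    have hcM : c * mom 'X^(M + d) <= `|L M| by near: M.
    have M0 : (0 < M)%N by near: M; exact: nbhs_infty_gt.
    have p := moment_Xn_gt0 hE (M + d).
    have NK : C * 2 / c + S *+ 2 + 1 <= (N M)%:R by near: M.
    have n1' : 1 <= n%:R :> R by rewrite ler1n.
    have : (n%:R * (N M)%:R - S *+ 2) * (c * mom 'X^(M + d)) <= C * 2 * mom 'X^(M + d).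
      apply: (@le_trans _ _ (`|mom (A n.-1 * 'X * 'X^M)| * 2)); last first.
        by rewrite [leRHS]mulrAC ler_wpM2r.
      rewrite (pearson_norm _ M0 (L_ne0 _ hcM)) ler_pM//.
      + rewrite subr_ge0 (le_trans _ (ler_peMl _ n1'))// (le_trans _ NK)//.
        by rewrite addrAC lerDr addr_ge0// divr_ge0 ?mulr_ge0 ?ltW.
      + by rewrite mulr_ge0 ?ltW.
      + rewrite lerBlDr -[leLHS]ger0_norm ?mulr_ge0// /S -normrMn.
        by rewrite -{1}[_ * _](addrK (s *+ 2)) ler_normB.
    rewrite mulrA ler_pM2r// -ler_pdivlMr// lerBlDr => h.
    have : (N M)%:R <= C * 2 / c + S *+ 2 by rewrite (le_trans _ h)// ler_peMl.
    by move=> /(le_trans NK); rewrite gerDl ler10.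
  have [e se] : exists e, size (A n.-1 * 'X) = e.+1.
    by exists (size (A n.-1 * 'X)%R).-1; rewrite prednK// (leq_trans _ sB).
  have de : (d.+1 <= e)%N by rewrite -ltnS -se.
  have [c' c'0 hc'] := moment_norm_ge hE far se.
  have [C C0 hC] := moment_norm_le hE far (eq_leq sd).
  exists ((n%:R + S *+ 2) * C / (2 * c')).
    have nS : 0 < n%:R + S *+ 2 by rewrite ltr_pwDl ?ltr0n.
    by rewrite divr_gt0 ?(mulr_gt0 nS C0)// mulr_gt0.
  near=> M.
  have hCM : `|mom (A n * 'X^M)| <= C * mom 'X^(M + d) by near: M.
  have hcM : c * mom 'X^(M + d) <= `|L M| by near: M.
  have hc'M : c' * mom 'X^(M + e) <= `|mom (A n.-1 * 'X * 'X^M)| by near: M.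
  have mono : forall i, (i <= e)%N -> mom 'X^(M + i) <= mom 'X^(M + e).
    by near: M; exact: moment_nondecr.
  have M0 : (0 < M)%N by near: M; exact: nbhs_infty_gt.
  have N1 : 1 <= (N M)%:R :> R by near: M.
  have p := moment_Xn_gt0 hE (M + d).
  rewrite -(ler_pM2l (mulr_gt0 (ltr0Sn R 1) c'0)).
  have -> : 2 * c' * ((n%:R + S *+ 2) * C / (2 * c') * (N M)%:R * mom 'X^(M + d)) =
      ((n%:R + S *+ 2) * (N M)%:R) * (C * mom 'X^(M + d)).
    by field; rewrite gt_eqF.
  apply: (@le_trans _ _ (`|mom (A n.-1 * 'X * 'X^M)| * 2)).
    rewrite mulrC mulrCA mulrC ler_wpM2r// (le_trans _ hc'M)//.
    by rewrite mulrC ler_wpM2l ?(ltW c'0)// -addnS mono.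
  rewrite (pearson_norm _ M0 (L_ne0 _ hcM)) ler_pM//.
  rewrite (le_trans (ler_normD _ _))// normrMn normrM !normr_nat mulrDl lerD2l.
  by rewrite ler_peMr// mulrn_wge0.
have low : exists2 C, 0 < C & \forall M \near \oo,
    (N M)%:R ^+ n * `|L M| <= C * (N M)%:R ^+ m * mom 'X^(M + n).
  have [C C0 hC] : exists2 C, 0 < C & \forall M \near \oo, forall k, (0 < k <= n)%N ->
      `|mom (A k * 'X^(N M - k))| <= C * mom 'X^(M + n).
    suff: forall q, (q <= n)%N -> exists2 C, 0 < C &
      \forall M \near \oo, forall k, (0 < k <= q)%N ->
      `|mom (A k * 'X^(N M - k))| <= C * mom 'X^(M + n) by apply.
    elim=> [|q IH] qn; first by exists 1 => //; near=> M => k; rewrite andbC; case: k.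
    have [C C0 hC] := IH (ltnW qn).
    have sq : (size (A q.+1 * 'X^(n - q.+1))%R <= n.+1)%N.
      have [->|Aq] := eqVneq (A q.+1) 0; first by rewrite mul0r size_poly0.
      rewrite size_mulXn// (leq_trans (leq_add (leqnn _) (sz q.+1 _)))//.
      by rewrite addnS subnK.
    have [C' C'0 hC'] := moment_norm_le hE far sq.
    exists (C + C'); first exact: addr_gt0.
    near=> M => k /andP[k0].
    have h : forall k, (0 < k <= q)%N ->
      `|mom (A k * 'X^(N M - k))| <= C * mom 'X^(M + n) by near: M.
    have h' : `|mom (A q.+1 * 'X^(n - q.+1) * 'X^M)| <= C' * mom 'X^(M + n) by near: M.
    have p := moment_Xn_gt0 hE (M + n).
    rewrite leq_eqVlt mulrDl => /orP[/eqP ->|kq].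
      rewrite ler_wpDl ?mulr_ge0 ?(ltW C0) ?(ltW p)//.
      by rewrite /N -addnBA// addnC exprD mulrA.
    by rewrite ler_wpDr ?mulr_ge0 ?(ltW C'0) ?(ltW p)// h// k0.
  pose W := 1 + \sum_(k < n.+1) \sum_(j < n.+1) `|(ffact_poly k)`_j|.
  have W0 : 0 < W by rewrite ltr_pwDl// sumr_ge0// => k _; rewrite sumr_ge0.
  have hW k j : (k <= n)%N -> (j <= n)%N -> `|(ffact_poly k)`_j| <= W.
    rewrite -!(ltnS _ n) => kn jn; rewrite ler_wpDl//.
    rewrite (bigD1 (Ordinal kn))//= (bigD1 (Ordinal jn))//= -addrA lerDl.
    by rewrite addr_ge0 ?sumr_ge0// => i _; rewrite sumr_ge0.
  exists (m`!%:R * m.+1%:R * (n%:R * W * C)).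
    by rewrite !mulr_gt0 ?ltr0n ?fact_gt0.
  near=> M.
  have h : forall k, (0 < k <= n)%N ->
    `|mom (A k * 'X^(N M - k))| <= C * mom 'X^(M + n) by near: M.
  have M0 : (0 < M)%N by near: M; exact: nbhs_infty_gt.
  have N0 : (0 < N M)%N by rewrite addn_gt0 M0.
  have p := moment_Xn_gt0 hE (M + n).
  have := reflection_invariant_lead_le (power_symbol_invariant N0 (leq_addl _ _) sA).
  move=> /(_ m); rewrite -nm => /(_ (size_power_symbol _)).
  rewrite gn normrM normrX normr_nat => hh; apply: (le_trans hh).
  rewrite -!mulrA ler_wpM2l//.
  rewrite mulr_natl -[X in _ *+ X](card_ord m.+1) -sumr_const ler_sum// => j _.
  rewrite coef_power_symbol (le_trans (ler_norm_sum _ _ _))//.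
  have nE (x : R) : n%:R * x = \sum_(1 <= k < n.+1) x by rewrite sumr_const_nat subn1 mulr_natl.
  rewrite nE.
  rewrite big_nat_cond [leRHS]big_nat_cond; apply: ler_sum => k; rewrite andbT => /andP[k0 kn].
  have jm : (j <= m)%N by rewrite -ltnS.
  rewrite !normrM normrX normr_nat [C * _]mulrCA [leRHS]mulrA.
  rewrite ler_pM ?mulr_ge0 ?exprn_ge0//; last by rewrite h// k0.
  rewrite ler_pM ?exprn_ge0//; last by rewrite ler_weXn2l// ler1n.
  by rewrite hW// (leq_trans jm)// nm -addnn leq_addr.
have [C C0 [M0 _ hC]] := ratio; have [C2 C20 hC2] := low.
have chain i M : (M0 <= M)%N -> (i <= n)%N ->
    mom 'X^(M + d + i) <= (C * (N (M + n)%N)%:R) ^+ i * mom 'X^(M + d).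
  move=> hM; elim: i => [|i IH] iln; first by rewrite addn0 mul1r.
  rewrite addnS -addnA (addnC d) addnA.
  have hCM := hC (M + i)%N (leq_trans hM (leq_addr _ _)).
  apply: (le_trans hCM); rewrite exprS -[leRHS]mulrA ler_pM ?mulr_ge0 ?(ltW C0)//.
  - by rewrite ltW// moment_Xn_gt0.
  - by rewrite ler_wpM2l ?(ltW C0)// ler_nat /N leq_add2r leq_add2l ltnW.
  - by rewrite addnAC IH// ltnW.
rewrite sd ltnS leqNgt; apply/negP => md.
suff : \forall M \near \oo, False by move=> /filter_ex[].
near=> M.
have hM : (M0 <= M)%N by near: M; exact: nbhs_infty_ge.
have hcM : c * mom 'X^(M + d) <= `|L M| by near: M.
have hC2M : (N M)%:R ^+ n * `|L M| <= C2 * (N M)%:R ^+ m * mom 'X^(M + n) by near: M.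
have N1 : 1 <= (N M)%:R :> R by near: M.
pose K := C2 * (C * 2) ^+ (n - d) / c.
have NK : K + 1 <= (N M)%:R by near: M.
have p := moment_Xn_gt0 hE (M + d).
have NM0 : 0 < (N M)%:R :> R by rewrite (lt_le_trans _ N1).
have up : mom 'X^(M + n) <= (C * 2) ^+ (n - d) * (N M)%:R ^+ (n - d) * mom 'X^(M + d).
  have := chain (n - d)%N M hM (leq_subr _ _); rewrite -addnA subnKC// => /le_trans; apply.
  rewrite ler_wpM2r ?(ltW p)// -exprMn lerXn2r ?nnegrE ?mulr_ge0 ?(ltW C0)//.
  by rewrite -mulrA ler_wpM2l ?(ltW C0)// -natrM ler_nat /N mulSn mul1n leq_add2l leq_addl.
have : (N M)%:R ^+ n * c * mom 'X^(M + d) <= K * c * (N M)%:R ^+ (m + (n - d)) * mom 'X^(M + d).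
  apply: (@le_trans _ _ ((N M)%:R ^+ n * `|L M|)).
    by rewrite -mulrA ler_wpM2l ?exprn_ge0.
  apply: (le_trans hC2M).
  have -> : K * c * (N M)%:R ^+ (m + (n - d)) * mom 'X^(M + d) =
    C2 * (N M)%:R ^+ m * ((C * 2) ^+ (n - d) * (N M)%:R ^+ (n - d) * mom 'X^(M + d)).
    by rewrite exprD /K; field; rewrite gt_eqF.
  by rewrite ler_wpM2l// mulr_ge0 ?exprn_ge0 ?(ltW C20).
rewrite ler_pM2r// mulrAC ler_pM2r//.
have e1 : (N M)%:R ^+ (m + (n - d)) * (N M)%:R <= (N M)%:R ^+ n :> R.
  have mn : (m + (n - d) < d + (n - d))%N by rewrite ltn_add2r.
  by rewrite -exprSr ler_weXn2l// (leq_trans mn)// subnKC.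
move=> /(le_trans e1); rewrite [leRHS]mulrC ler_pM2l ?exprn_gt0// => /(le_trans NK).
by rewrite gerDl ler10.
Unshelve. all: by end_near. Qed.

End InfinityTheorem.
(** * Integration against a weight *)

Section WeightedMean.
Context {R : realType} (l r : \bar R) (p : R -> R) (e sg : R).
Let I := open_interval l r.
Local Notation mu := (@lebesgue_measure R).

Lemma open_interval_open : open I.
Proof. by apply: openI; [exact: open_ereal_gt|exact: open_ereal_lt]. Qed.

Lemma open_interval_measurable : measurable I.
Proof. by apply: open_measurable; exact: open_interval_open. Qed.

Hypothesis p_continuous : {in I, continuous p}.
Hypothesis p_gt0 : forall x, I x -> 0 < p x.
Hypothesis p_admissible : admissible I p.
Hypothesis sg2 : sg * sg = 1.
Hypothesis coord_gt0 : forall x, I x -> 0 < sg * (x - e).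

(** The integral in the coordinate [sg * (x - e)], [sg = 1] or [-1], which puts
    the endpoint [e] at 0 and the interval on the positive side. *)
Definition weighted_mean (f : R -> R) := \int[mu]_(x in I) (p x * f (sg * (x - e))).

Let mI := open_interval_measurable.

Lemma weighted_measurable f : continuous f ->
  measurable_fun I (fun x => p x * f (sg * (x - e))).
Proof.
move=> cf; apply: open_continuous_measurable_fun; first exact: open_interval_open.
move=> x Ix; apply: cvgM; first exact: p_continuous.
apply: continuous_comp; last exact: cf.
by apply: cvgM; [exact: cvg_cst|apply: cvgB; [exact: cvg_id|exact: cvg_cst]].
Qed.

Lemma weighted_integrable f : tame f ->
  mu.-integrable I (EFin \o (fun x => p x * f (sg * (x - e)))).
Proof.
move=> [cf [q hq]]; apply/integrableP; split.
  by apply/measurable_EFinP; exact: weighted_measurable.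
pose Q := q \Po (sg *: ('X - e%:P)).
have QE x : Q.[x] = q.[sg * (x - e)] by rewrite /Q horner_comp !hornerE.
apply: le_lt_trans (p_admissible Q).
apply: ge0_le_integral => //.
- by apply/measurable_EFinP/measurableT_comp => //; exact: weighted_measurable.
- apply/measurable_EFinP.
  rewrite (_ : (fun x => p x * `|Q.[x]|) =
      fun x => p x * (fun y => `|q.[y]|) (sg * (x - e))).
    have cq : continuous (fun y => `|q.[y]|).
      by move=> y; apply: cvg_norm; exact: continuous_horner.
    exact: weighted_measurable cq.
  by apply/funext => x; rewrite QE.
- move=> x Ix; rewrite lee_fin normrM gtr0_norm ?p_gt0// ler_wpM2l ?(ltW (p_gt0 _))//.
  by rewrite QE (le_trans (hq _ _)) ?coord_gt0// ler_norm.
Qed.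

Lemma weighted_mean_gt0 f (a b : R) : tame f ->
  (forall x, I x -> 0 <= f (sg * (x - e))) -> a < b ->
  (forall x, a < sg * (x - e) < b -> I x /\ 0 < f (sg * (x - e))) ->
  0 < weighted_mean f.
Proof.
move=> tf f0 ab hf.
pose g x := p x * f (sg * (x - e)).
have g0 x : I x -> 0 <= g x by move=> Ix; rewrite mulr_ge0 ?f0// ltW// p_gt0.
have ig := weighted_integrable tf.
rewrite lt0r Rintegral_ge0 ?andbT//; apply/eqP => E0.
have mg : measurable_fun I (EFin \o g) by case/integrableP: ig.
have : (\int[mu]_(x in I) `|(g x)%:E| = 0)%E.
  have -> : (\int[mu]_(x in I) `|(g x)%:E| = \int[mu]_(x in I) (g x)%:E)%E.
    by apply: eq_integral => x /set_mem Ix; rewrite gee0_abs// lee_fin g0.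
  rewrite -[LHS]fineK; last exact: integrable_fin_num.
  by congr EFin.
move/(ae_eq_integral_abs mu mI mg) => [N [mN N0 hN]].
pose x0 := e + sg * ((a + b) / 2); pose h := (b - a) / 2.
have h0 : 0 < h by rewrite divr_gt0// subr_gt0.
have sub : `]x0 - h, x0 + h[ `<=` N.
  move=> x; rewrite /= in_itv/= => hx; apply: hN => /= hh.
  have nsg : `|sg| = 1.
    have : `|sg| ^+ 2 = 1 ^+ 2 by rewrite expr1n -normrX expr2 sg2 normr1.
    by move/eqP; rewrite eqrXn2 ?normr_ge0// => /eqP.
  have xx : `|sg * (x - e) - (a + b) / 2| < h.
    have -> : sg * (x - e) - (a + b) / 2 = sg * (x - x0).
      transitivity (sg * (x - e) - sg * sg * ((a + b) / 2)); first by rewrite sg2 mul1r.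
      by rewrite /x0; ring.
    by rewrite normrM nsg mul1r ltr_distl.
  have {}xx : a < sg * (x - e) < b.
    move: xx; rewrite ltr_distl /h => /andP[h1 h2]; apply/andP; split; lra.
  have [Ix fx] := hf x xx.
  by case: (hh Ix) => /eqP; rewrite gt_eqF// mulr_gt0 ?p_gt0.
have : (mu [set` `](x0 - h)%R, (x0 + h)%R[] <= mu N)%E by apply: le_measure => //; rewrite inE.
have hh : x0 - h < x0 + h by rewrite ltrBlDr -addrA ltrDl addr_gt0.
by rewrite N0 lebesgue_measure_itv/= lte_fin hh -EFinD lee_fin leNgt subr_gt0 hh.
Qed.

Hypothesis coord_small : exists2 h : R, 0 < h & forall x, 0 < sg * (x - e) < h -> I x.

(** The integral does not charge the endpoint: [mean_decay] follows by dominated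
    convergence along [t = 0, 1, 2, ...]. *)
Lemma weighted_mean_half_line : half_line_mean weighted_mean.
Proof.
split.
- move=> c f g tf tg; rewrite /weighted_mean.
  have /= i1 := weighted_integrable tf; have /= i2 := weighted_integrable tg.
  rewrite -RintegralZl// -RintegralD//.
    by apply: eq_Rintegral => x _; rewrite /=; ring.
  have := @integrableZl _ _ _ mu I mI c (EFin \o (fun x => p x * f (sg * (x - e)))) i1.
  by [].
- move=> f g tf tg h; apply: le_Rintegral => //; try exact: weighted_integrable.
  by move=> x Ix; rewrite ler_wpM2l ?h ?coord_gt0// ltW// p_gt0.
- move=> f eta tf f0 eta0 hf; have [h h0 hI] := coord_small.
  apply: (@weighted_mean_gt0 _ 0 (Num.min eta h)) => //.
  + by move=> x Ix; rewrite f0// coord_gt0.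
  + by rewrite lt_min eta0.
  + move=> x; rewrite lt_min => /and3P[x0 x1 x2].
    by split; [apply: hI; rewrite x0|apply: hf; rewrite x0].
- move=> d d0.
  pose f_ n x := (p x * expR (- n%:R * (sg * (x - e))))%:E.
  have := @dominated_convergence _ _ R mu I mI f_ (cst 0%E) (EFin \o p).
  have tn n : tame (fun x : R => expR (- n%:R * x)) by apply: tame_exp.
  case.
  + by move=> n; have [cn _] := tn n; apply/measurable_EFinP; exact: weighted_measurable cn.
  + exact: measurable_cst.
  + apply: aeW => x Ix; apply: cvg_EFin; first by apply: nearW.
    rewrite (_ : _ \o _ = geometric (p x) (expR (- (sg * (x - e))))).
      apply: cvg_geometric; rewrite ger0_norm ?expR_ge0// -expR0 ltr_expR.
      by rewrite oppr_lt0 coord_gt0.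
    by apply/funext => n /=; rewrite -expRM_natl mulNr mulrN.
  + have := weighted_integrable (tn 0%N); congr (_.-integrable _ _); apply/funext => x /=.
    by rewrite oppr0 mul0r expR0 mulr1.
  + apply: aeW => x n Ix; rewrite lee_fin normrM gtr0_norm ?p_gt0// ler_piMr ?(ltW (p_gt0 _))//.
    by rewrite ger0_norm ?expR_ge0// -expR0 ler_expR mulNr oppr_le0 mulr_ge0// ltW// coord_gt0.
  move=> _ _; rewrite integral0 => /fine_cvg h.
  have /filter_ex[n hn] : \forall n \near \oo, fine (\int[mu]_(x in I) f_ n x) < d.
    by apply: (cvgr_lt 0).
  by exists n%:R.
Qed.

Lemma weighted_mean_far : (forall x, 0 < sg * (x - e) -> I x) ->
  forall f K, tame f -> (forall x, 0 < x -> 0 <= f x) ->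
  (forall x, K < x -> 0 < f x) -> 0 < weighted_mean f.
Proof.
move=> full f K tf f0 fK.
apply: (@weighted_mean_gt0 _ (Num.max 0 K) (Num.max 0 K + 1)) => //.
- by move=> x Ix; rewrite f0// coord_gt0.
- by rewrite ltrDl.
- move=> x; rewrite gt_max -andbA => /and3P[x0 xK _].
  by split; [exact: full|exact: fK].
Qed.

End WeightedMean.
(** * Continuity and positivity of the weight *)

Section Weight.
Context {R : realType} (l r : \bar R).
Let I := open_interval l r.
Local Notation mu := (@lebesgue_measure R).

Lemma open_interval_convex x y z : I x -> I y -> x <= z <= y -> I z.
Proof.
move=> [lx _] [_ yr] /andP[xz zy]; split.
  by rewrite (lt_le_trans lx)// lee_fin.
by rewrite (le_lt_trans _ yr)// lee_fin.
Qed.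

Lemma oriented_integral_continuous (p0 : R) (f : R -> R) : I p0 ->
  {in I, continuous f} -> {in I, continuous (fun x => oriented_integral p0 x f)}.
Proof.
move=> I0 cf x /set_mem Ix.
have room y : I y -> exists2 d : R, 0 < d & I (y - d) /\ I (y + d).
  move=> Iy; have := @open_interval_open R l r; rewrite openE => /(_ _ Iy).
  move=> /nbhs_ballP[d /= d0 h]; exists (d / 2); first exact: divr_gt0.
  have hd : `|d / 2| < d by rewrite gtr0_norm ?divr_gt0// ltr_pdivrMr// ltr_pMr// ltr1n.
  split; apply: h; rewrite /ball/=.
    by rewrite opprB addrC subrK.
  by rewrite opprD addrA subrr add0r normrN.
have [u Iu [u0 ux]] : exists2 u, I u & u < p0 /\ u < x.
  have [d d0 [h _]] := room _ I0; have [d' d'0 [h' _]] := room _ Ix.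
  have [px|xp] := leP p0 x; [exists (p0 - d)|exists (x - d')] => //; split.
  - by rewrite gtrBl.
  - by rewrite (lt_le_trans _ px)// gtrBl.
  - by rewrite (lt_trans _ xp)// gtrBl.
  - by rewrite gtrBl.
have [v Iv [v0 vx]] : exists2 v, I v & p0 < v /\ x < v.
  have [d d0 [_ h]] := room _ I0; have [d' d'0 [_ h']] := room _ Ix.
  have [px|xp] := leP p0 x; [exists (x + d')|exists (p0 + d)] => //; split.
  - by rewrite (le_lt_trans px)// ltrDl.
  - by rewrite ltrDl.
  - by rewrite ltrDl.
  - by rewrite (lt_trans xp)// ltrDl.
have uv : u < v := lt_trans u0 v0.
have cfuv : {within `[u, v], continuous f}.
  apply: continuous_in_subspaceT => y; rewrite inE/= in_itv/= => uyv.
  by apply: cf; rewrite inE; exact: open_interval_convex uyv.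
have ifuv : mu.-integrable `[u, v] (EFin \o f).
  by apply: continuous_compact_integrable => //; exact: segment_compact.
pose G y := \int[mu]_(t in `[u, y]) f t.
have cG : {for x, continuous G}.
  have /(continuous_within_itvP _ uv)[cG _ _] := parameterized_integral_continuous (ltW uv) ifuv.
  by apply: cG; rewrite in_itv/= ux.
have sub y z : u <= y -> y <= z -> z <= v ->
    \int[mu]_(t in `[y, z]) f t = G z - G y.
  move=> uy yz zv.
  have i1 : mu.-integrable `[u, z] (EFin \o f).
    by apply: integrableS ifuv => //; apply: subset_itvl; rewrite bnd_simp.
  have := @Rintegral_itvB _ f (BLeft u) (BRight z) y i1.
  rewrite !bnd_simp => /(_ uy yz) ->.
  rewrite Rintegral_itv_obnd_cbnd//; apply: integrableS i1 => //.
  by apply: subset_itvr; rewrite bnd_simp.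
have eG : \forall y \near x, G y - G p0 = oriented_integral p0 y f.
  have xuv : x \in `]u, v[ by rewrite in_itv/= ux.
  have near_uv : \forall y \near x, y \in `]u, v[ := near_in_itvoo xuv.
  near=> y; have : y \in `]u, v[ by near: y.
  rewrite in_itv/= => /andP[uy yv]; rewrite /oriented_integral.
  case: leP => yp; first by rewrite sub ?(ltW u0) ?(ltW yv).
  by rewrite sub ?(ltW uy) ?(ltW yp) ?(ltW v0)// opprB.
rewrite /continuous_at -(nbhs_singleton eG).
apply: (cvg_trans (near_eq_cvg eG)).
by apply: cvgB; [exact: cG|exact: cvg_cst].
Unshelve. all: by end_near. Qed.

Variables (a : nat -> {poly R}) (n : nat) (p0 : R).
Hypothesis I0 : I p0.
Hypothesis no_zero : forall x, I x -> ~~ root (a n) x.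

Lemma weight_gt0 x : I x -> 0 < weight a n p0 x.
Proof.
by move=> Ix; rewrite mulr_gt0 ?expR_gt0// invr_gt0 normr_gt0 no_zero.
Qed.

Lemma weight_continuous : {in I, continuous (weight a n p0)}.
Proof.
move=> x /[dup] xI /set_mem Ix.
have nz := no_zero Ix; rewrite /root in nz.
apply: cvgM.
  apply: cvgV; first by rewrite normr_eq0.
  by apply: cvg_norm; exact: continuous_horner.
apply: continuous_comp; last exact: continuous_expR.
apply: cvgM; first exact: cvg_cst.
apply: oriented_integral_continuous => // y /set_mem Iy.
apply: cvgM; first exact: continuous_horner.
apply: cvgV; first exact: no_zero Iy.
exact: continuous_horner.
Qed.

End Weight.
(** * Exponentials and polynomials as test functions *)

Section TestFunctions.
Context {R : realType}.
Implicit Types (P : {poly R}) (I : set R) (c d t x : R).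

Lemma derive1n_horner P k : derive1n k (horner P) = horner (P^`(k)).
Proof.
by elim: k P => [|k IH] P; [rewrite derivn0|rewrite derive1nS IH -derivE -derivnS].
Qed.

Lemma test_function_horner I P : test_function I (horner P).
Proof.
split=> k; first by move=> x _; rewrite derive1n_horner; exact: derivable_horner.
exists (1 + P^`(k) ^+ 2) => x _; rewrite derive1n_horner !hornerE.
rewrite -[X in _ <= 1 + X]real_normK ?num_real//; set z := `|_|.
have : 0 <= z by exact: normr_ge0.
nra.
Qed.

Lemma is_derive_exp_affine c d x :
  is_derive x 1 (fun y => expR (c * y + d)) (c * expR (c * x + d)).
Proof.
pose q := c *: 'X + d%:P.
rewrite (_ : (fun y => _) = expR \o horner q); last first.
  by apply/funext => y; rewrite /= !hornerE.
have dq := @derivable_horner _ q x; have dE := @derivable_expR R q.[x].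
apply: DeriveDef.
  by apply/derivable1_diffP/differentiable_comp; exact/derivable1_diffP.
rewrite -derive1E derive1_comp// -derivE derive1E derive_val mulrC.
by rewrite derivD derivZ derivX derivC !hornerE.
Qed.

Lemma derive1n_exp_affine k c d :
  derive1n k (fun y => expR (c * y + d)) = fun y => c ^+ k * expR (c * y + d).
Proof.
elim: k => [|k IH]; first by apply/funext => y; rewrite mul1r.
rewrite derive1nS IH; apply/funext => y; rewrite derive1E.
have h := is_derive_exp_affine c d y.
have hZ : is_derive y 1 (fun y => c ^+ k * expR (c * y + d)) (c ^+ k * (c * expR (c * y + d))).
  exact: is_deriveZ.
by rewrite derive_val exprSr mulrA.
Qed.

Lemma test_function_exp_affine I c d : (forall x, I x -> c * x + d <= 0) ->
  test_function I (fun y => expR (c * y + d)).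
Proof.
move=> hI; split=> k.
  move=> x _; rewrite derive1n_exp_affine; have h := is_derive_exp_affine c d x.
  have [//] : is_derive x 1 (fun y => c ^+ k * expR (c * y + d)) (c ^+ k * (c * expR (c * x + d))).
  exact: is_deriveZ.
exists (`|c| ^+ k)%:P => x Ix; rewrite derive1n_exp_affine hornerC normrM normrX.
rewrite ler_piMr ?exprn_ge0// ger0_norm ?expR_ge0//.
by rewrite -expR0 ler_expR hI.
Qed.

Lemma derivn_comp_affine P (q : {poly R}) c k : q^`() = c%:P ->
  (P \Po q)^`(k) = c ^+ k *: (P^`(k) \Po q).
Proof.
move=> dq; elim: k => [|k IH]; first by rewrite !derivn0 scale1r.
rewrite derivnS IH derivZ deriv_comp dq derivnS.
by rewrite mulrC mul_polyC scalerA exprSr.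
Qed.

End TestFunctions.
(** * Multiplicities *)

Section Multiplicity.
Context {R : fieldType}.
Implicit Types (q : {poly R}) (x : R).

Lemma mup_split q x : q != 0 ->
  exists2 b, q = b * ('X - x%:P) ^+ mup x q & ~~ root b x.
Proof.
move=> q0; have [m [b hb e]] := multiplicity_XsubC q x.
rewrite q0 in hb; exists b => //; rewrite e mupMr// mup_XsubCX eqxx//.
Qed.

Lemma sum_mup_lt_size q (s : seq R) : q != 0 -> uniq s ->
  (\sum_(x <- s) mup x q < size q)%N.
Proof.
elim: s q => [|x s IH] q q0 /=; first by rewrite big_nil size_poly_gt0.
move=> /andP[xs us]; rewrite big_cons; have [b e bx] := mup_split x q0.
have b0 : b != 0 by apply: contraNneq bx => ->; rewrite root0.
have xn : ('X - x%:P) ^+ mup x q != 0 by rewrite expf_neq0 ?polyXsubC_eq0.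
have -> : size q = (mup x q + size b)%N.
  by rewrite {1}e size_Mmonic ?monic_exp ?monicXsubC// size_exp_XsubC addnS /= addnC.
rewrite ltn_add2l; apply: leq_ltn_trans (IH _ b0 us).
rewrite leq_eqVlt; apply/orP; left; apply/eqP; apply: eq_big_seq => y ys.
rewrite {1}e mupM// mup_XsubCX ifN ?addn0//.
by apply: contraNneq xs => ->.
Qed.

End Multiplicity.

(** * Transfer to the operator at an endpoint *)

Section AtEndpoint.
Context {R : realType} (n : nat) (a : nat -> {poly R}) (l r : \bar R) (p0 : R).
Let I := open_interval l r.
Let p := weight a n p0.
Hypothesis n2 : (2 < n)%N.
Hypothesis size_a : forall k : nat, (1 <= k <= n)%N -> (size (a k) <= k.+1)%N.
Hypothesis an0 : a n != 0.
Hypothesis no_zero : forall x, I x -> ~~ root (a n) x.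
Hypothesis I0 : I p0.
Hypothesis p_admissible : admissible I p.
Hypothesis L_self_adjoint : self_adjoint I p a n.

Variables (e sg : R).
Hypothesis sg2 : sg * sg = 1.
Hypothesis coord_gt0 : forall x, I x -> 0 < sg * (x - e).
Hypothesis coord_small : exists2 h : R, 0 < h & forall x, 0 < sg * (x - e) < h -> I x.

Let E := weighted_mean l r p e sg.

Lemma endpoint_mean : half_line_mean E.
Proof.
apply: weighted_mean_half_line => //.
  exact: weight_continuous.
exact: weight_gt0.
Qed.
Let hE := endpoint_mean.

Let sg0 : sg != 0.
Proof. by apply/eqP => z; move: sg2; rewrite z mul0r => /esym/eqP; rewrite oner_eq0. Qed.

(** The inverse of the coordinate, as [sg] is its own inverse. *)
Definition coord_inv : {poly R} := e%:P + sg *: 'X.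
(** The coefficients of the operator in the coordinate: each derivative
    contributes a factor [sg]. *)
Definition coord_coef k := sg ^+ k *: (a k \Po coord_inv).

Lemma size_coord_inv : size coord_inv = 2%N.
Proof. by rewrite /coord_inv addrC size_polyDl size_scale ?size_polyX// ltnS size_polyC_leq1. Qed.

Lemma size_coord_coef k : size (coord_coef k) = size (a k).
Proof. by rewrite size_scale ?expf_neq0// size_comp_poly2 ?size_coord_inv. Qed.

Lemma coord_coef_horner k x : (coord_coef k).[sg * (x - e)] = sg ^+ k * (a k).[x].
Proof.
rewrite hornerZ horner_comp /coord_inv hornerD hornerC hornerZ hornerX mulrA sg2.
by rewrite mul1r addrC subrK.
Qed.

Lemma coord_coef_order k : a k != 0 ->
  exists2 B, coord_coef k = 'X^(mup e (a k)) * B & B`_0 != 0.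
Proof.
move=> ak0; have [b eb be] := mup_split e ak0; set d := mup e (a k) in eb *.
exists (sg ^+ (k + d) *: (b \Po coord_inv)).
  rewrite /coord_coef eb rmorphM /= rmorphXn /= rmorphB /= comp_polyX comp_polyC.
  have -> : coord_inv - e%:P = sg *: 'X by rewrite /coord_inv addrC addKr.
  rewrite exprZn -!scalerAr scalerA -exprD.
  by rewrite [_ * 'X^d]mulrC.
rewrite -horner_coef0 hornerZ horner_comp mulf_neq0 ?expf_neq0//.
by rewrite /coord_inv !hornerE.
Qed.

Lemma endpoint_exp_symmetric : @exp_symmetric R E n coord_coef.
Proof.
move=> s t s0 t0; have st0 := addr_ge0 s0 t0.
pose y u x := expR (- (u * sg) * x + u * sg * e).
have yE u x : y u x = expR (- u * (sg * (x - e))) by congr expR; ring.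
have ty u : 0 <= u -> test_function I (y u).
  move=> u0; apply: test_function_exp_affine => x Ix.
  have -> : - (u * sg) * x + u * sg * e = - (u * (sg * (x - e))) by ring.
  by rewrite oppr_le0 mulr_ge0// ltW// coord_gt0.
have dy u x : diffop a n (y u) x =
    (\sum_(1 <= k < n.+1) (- u) ^+ k *: coord_coef k).[sg * (x - e)] * y u x.
  rewrite horner_sum mulr_suml; apply: eq_bigr => k _.
  rewrite derive1n_exp_affine hornerZ coord_coef_horner -/(y u x).
  have -> : - (u * sg) = - u * sg by rewrite mulNr.
  by rewrite exprMn; ring.
have yy x : y s x * y t x = expR (- (s + t) * (sg * (x - e))).
  by rewrite !yE -expRD; congr expR; ring.
have lapE u : \sum_(1 <= k < n.+1) (- u) ^+ k * laplace E (coord_coef k) (s + t) =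
    laplace E (\sum_(1 <= k < n.+1) (- u) ^+ k *: coord_coef k) (s + t).
  by rewrite (laplace_sum hE)//; apply: eq_bigr => k _; rewrite [RHS](laplaceZ hE).
rewrite !lapE /laplace /E /weighted_mean.
transitivity (\int[lebesgue_measure]_(x in I) (p x * diffop a n (y s) x * y t x)).
  apply: eq_Rintegral => x _; rewrite -[RHS](mulrA (p x)) dy.
  by rewrite -[in RHS](mulrA _.[_]) yy.
rewrite (L_self_adjoint (ty _ s0) (ty _ t0)).
apply: eq_Rintegral => x _; rewrite -[LHS](mulrA (p x)) dy.
by rewrite [y s x * _]mulrCA yy.
Qed.

Lemma endpoint_power_symmetric : @power_symmetric R E n coord_coef.
Proof.
pose q : {poly R} := sg *: ('X - e%:P).
pose y i := horner ('X^i \Po q).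
have qE x : q.[x] = sg * (x - e) by rewrite !hornerE.
have dq : q^`() = sg%:P by rewrite derivZ derivXsubC -alg_polyC.
have dy i j x : diffop a n (y i) x * y j x =
    (\sum_(1 <= k < n.+1) (i ^_ k)%:R *: (coord_coef k * 'X^(i + j - k))).[sg * (x - e)].
  rewrite horner_sum mulr_suml; apply: eq_bigr => k _.
  rewrite /y derive1n_horner (derivn_comp_affine _ _ dq) derivnXn !hornerZ hornerM coord_coef_horner.
  rewrite !horner_comp hornerMn !hornerXn qE.
  have [ki|ik] := leqP k i; last by rewrite ffact_small// mulr0n !(mul0r, mulr0).
  by rewrite addnC -addnBA// exprD -mulr_natl; ring.
have lapE i m : \sum_(1 <= k < n.+1) (i ^_ k)%:R * @moment R E (coord_coef k * 'X^(m - k)) =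
    laplace E (\sum_(1 <= k < n.+1) (i ^_ k)%:R *: (coord_coef k * 'X^(m - k))) 0.
  by rewrite (laplace_sum hE)//; apply: eq_bigr => k _; rewrite [RHS](laplaceZ hE).
move=> i j; rewrite !lapE /laplace /E /weighted_mean.
transitivity (\int[lebesgue_measure]_(x in I) (p x * diffop a n (y i) x * y j x)).
  by apply: eq_Rintegral => x _; rewrite -[RHS](mulrA (p x)) dy oppr0 mul0r expR0 mulr1.
rewrite (L_self_adjoint (test_function_horner _ _) (test_function_horner _ _)).
apply: eq_Rintegral => x _; rewrite -[LHS](mulrA (p x)).
by rewrite [y i x * _]mulrC dy oppr0 mul0r expR0 mulr1 addnC.
Qed.

(** The last conclusion concerns an interval that extends from [e] to
    infinity. *)
Lemma endpoint_multiplicity : exists2 m, n = m.*2 &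
  [/\ (m <= mup e (a n))%N, (0 < mup e (a n.-1) < mup e (a n))%N &
      (forall x, 0 < sg * (x - e) -> I x) -> (size (a n) <= m.+1)%N].
Proof.
have An0 : coord_coef n != 0 by rewrite -size_poly_eq0 size_coord_coef size_poly_eq0.
have [m nm hm] := endpoint_order hE n2 An0 endpoint_exp_symmetric; exists m => //.
have [B eB B0] := coord_coef_order an0.
have [ma [b [C [eC C0 /andP[b0 ba]]]]] := hm _ _ eB B0.
have a1 : a n.-1 != 0.
  rewrite -size_poly_eq0 -size_coord_coef size_poly_eq0 eC.
  rewrite mulf_neq0 ?expf_neq0 ?polyX_eq0//; apply: contraNneq C0 => ->.
  by rewrite coef0.
have [C' eC' C'0] := coord_coef_order a1.
have mupE d (F : {poly R}) : F`_0 != 0 -> mup 0 ('X^d * F) = d.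
  move=> F0; rewrite mupMl; last by rewrite /root horner_coef0.
  by rewrite -['X]subr0 mup_XsubCX eqxx.
have bE : mup e (a n.-1) = b by rewrite -(mupE (mup e (a n.-1)) _ C'0) -eC' eC mupE.
split=> //; first by rewrite bE b0.
move=> full; rewrite -size_coord_coef.
apply: (@infinity_order _ _ hE _ n coord_coef) => //.
- apply: weighted_mean_far => //; [exact: weight_continuous|exact: weight_gt0].
- by rewrite -(ltn_double 1) -nm; exact: n2.
- by move=> k kn; rewrite size_coord_coef size_a.
- exact: endpoint_power_symmetric.
Qed.

End AtEndpoint.

Theorem proposition3p4 (R : realType) (n : nat) (a : nat -> {poly R})
    (l r : \bar R) (p0 : R) :
  (2 < n)%N ->
  (forall k : nat, (1 <= k <= n)%N -> (size (a k) <= k.+1)%N) ->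
  a n != 0 ->
  between_zeros (a n) l r ->
  open_interval l r p0 ->
  admissible (open_interval l r) (weight a n p0) ->
  self_adjoint (open_interval l r) (weight a n p0) a n ->
  forall c : R, root (a n) c ->
    [/\ (2 <= mup c (a n))%N, (0 < mup c (a n.-1))%N
      & (mup c (a n.-1) < mup c (a n))%N].
Proof.
move=> n2 size_a an0 [zl nz] I0 adm sa c rc.
have endp := endpoint_multiplicity n2 size_a an0 nz I0 adm sa.
have concl : (0 < mup c (a n.-1) < mup c (a n))%N ->
    [/\ (2 <= mup c (a n))%N, (0 < mup c (a n.-1))%N
      & (mup c (a n.-1) < mup c (a n))%N].
  by move=> /andP[h1 h2]; split=> //; apply: leq_ltn_trans h2.
have muc : (0 < mup c (a n))%N by rewrite -XsubC_dvd// -root_factor_theorem.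
have left_end L : l = L%:E -> exists2 m, n = m.*2 &
  [/\ (m <= mup L (a n))%N, (0 < mup L (a n.-1) < mup L (a n))%N &
      (forall x, L < x -> open_interval l r x) -> (size (a n) <= m.+1)%N].
  move=> lL; have [lp pr] := I0.
  have coord x : open_interval l r x -> 0 < 1 * (x - L).
    by move=> [lx _]; rewrite mul1r subr_gt0 -lte_fin -lL.
  have small : exists2 h, 0 < h & forall x, 0 < 1 * (x - L) < h -> open_interval l r x.
    exists (p0 - L); first by rewrite subr_gt0 -lte_fin -lL.
    move=> x; rewrite mul1r ltrD2r subr_gt0 => /andP[Lx xp]; split.
      by rewrite lL lte_fin.
    by rewrite (lt_trans _ pr)// lte_fin.
  have [m nm [h1 h2 h3]] := endp L 1 (mulr1 1) coord small.
  exists m => //; split=> // full; apply: h3 => x.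
  by rewrite mul1r subr_gt0; exact: full.
have right_end L : r = L%:E -> exists2 m, n = m.*2 &
  [/\ (m <= mup L (a n))%N, (0 < mup L (a n.-1) < mup L (a n))%N &
      (forall x, x < L -> open_interval l r x) -> (size (a n) <= m.+1)%N].
  move=> rL; have [lp pr] := I0.
  have coord x : open_interval l r x -> 0 < -1 * (x - L).
    by move=> [_ xr]; rewrite mulN1r opprB subr_gt0 -lte_fin -rL.
  have small : exists2 h, 0 < h & forall x, 0 < -1 * (x - L) < h -> open_interval l r x.
    exists (L - p0); first by rewrite subr_gt0 -lte_fin -rL.
    move=> x; rewrite mulN1r opprB subr_gt0 ltrD2l ltrN2 => /andP[xL px]; split.
      by rewrite (lt_trans lp)// lte_fin.
    by rewrite rL lte_fin.
  have sq : -1 * -1 = 1 :> R by rewrite mulrNN mulr1.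
  have [m nm [h1 h2 h3]] := endp L (-1) sq coord small.
  exists m => //; split=> // full; apply: h3 => x.
  by rewrite mulN1r opprB subr_gt0; exact: full.
have lfin : l = -oo%E \/ exists L, l = L%:E.
  by case: I0 => + _; case: (l) => [L||]//; [right; exists L|left].
have rfin : r = +oo%E \/ exists L, r = L%:E.
  by case: I0 => _; case: (r) => [L||]//; [right; exists L|left].
have sz : (size (a n) <= n.+1)%N by rewrite size_a// leqnn andbT (ltn_trans _ n2).
case: lfin rfin => [linf|[L lL]] [rinf|[M rM]].
- by have := nz c; rewrite rc linf rinf => /(_ (conj (ltNyr _) (ltry _))).
- have [m nm [h1 h2 h3]] := right_end _ rM.
  have [cM|cM] := eqVneq c M; first by apply: concl; rewrite cM.
  (* M has multiplicity at least m, which is at least the degree: there is no room for c *)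
  have := @sum_mup_lt_size _ (a n) [:: M; c] an0; rewrite /= inE eq_sym cM => /(_ isT).
  rewrite !big_cons big_nil addn0 => /leq_trans/(_ (h3 _)); rewrite ltnS.
  have full x : x < M -> open_interval l r x.
    by move=> xM; split; rewrite ?linf ?ltNyr// rM lte_fin.
  by move=> /(_ full); rewrite leqNgt => /negP[]; rewrite -addn1 leq_add.
- have [m nm [h1 h2 h3]] := left_end _ lL.
  have [cL|cL] := eqVneq c L; first by apply: concl; rewrite cL.
  have := @sum_mup_lt_size _ (a n) [:: L; c] an0; rewrite /= inE eq_sym cL => /(_ isT).
  rewrite !big_cons big_nil addn0 => /leq_trans/(_ (h3 _)); rewrite ltnS.
  have full x : L < x -> open_interval l r x.
    by move=> xL; split; rewrite ?rinf ?ltry// lL lte_fin.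
  by move=> /(_ full); rewrite leqNgt => /negP[]; rewrite -addn1 leq_add.
- have [m nm [h1 h2 _]] := left_end _ lL; have [m' nm' [h1' h2' _]] := right_end _ rM.
  have [cL|cL] := eqVneq c L; first by apply: concl; rewrite cL.
  have [cM|cM] := eqVneq c M; first by apply: concl; rewrite cM.
  have LM : L != M.
    have [lp pr] := I0; rewrite lt_eqF// -lte_fin -lL -rM; exact: lt_trans pr.
  have := @sum_mup_lt_size _ (a n) [:: L; M; c] an0.
  rewrite /= !inE negb_or LM ![_ == c]eq_sym cL cM => /(_ isT).
  rewrite !big_cons big_nil addn0 => /leq_trans/(_ sz); rewrite ltnS.
  have mm : m = m' by apply: double_inj; rewrite -nm.
  rewrite -mm in h1'; rewrite leqNgt => /negP[].
  apply: (@leq_trans (m + (m + 1))%N); first by rewrite addnA addn1 addnn -nm.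
  by rewrite leq_add// leq_add.
Qed.
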